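(* There exists a universal constant $\epsilon_0>0$ such that the following holds. Let $p$ be a fixed polynomial, let $\mathcal{G}$ be a finite graph, let $\mathcal{G}^*$ be the robust graph formed from $\mathcal{G}$ with $n:=|\mathcal{V}(\mathcal{G}^* )|$ and $\bar m$ the number of nonedges of $\mathcal{G}^*$, let $\hat p:=p(9\bar m+3n)$ and assume $\hat p>1$. Let $0<\epsilon\le \epsilon_0/(600\,\bar m^2 n\hat p)$, let $\delta:=\epsilon/(10\cdot 3^4\sqrt{6}\,\bar m^2n^{1/2})$, let $s>0$ be sufficiently large (depending on the preceding parameters), and let $B\in\mathbb{S}^{9\bar m+3n}$ be the matrix constructed from $\mathcal{G}^*,s,\delta,\epsilon,\hat p$ as described in the context. If $\mathcal{G}$ is 3-colorable, then there exist $H\in\mathbb{S}^{9\bar m+3n}$ with $\|H\|_F\le\epsilon$ and a vector $\mathbf{d}\in\mathbb{R}^{9\bar m+3n}$ such that $B+\operatorname{Diag}(\mathbf{d})+H\succeq 0$ and $\operatorname{rank}(B+\operatorname{Diag}(\mathbf{d})+H)\le 9\bar m+3$. On the other hand, if $\mathcal{G}$ is not 3-colorable, then for any $H\in\mathbb{S}^{9\bar m+3n}$ with $\|H\|_F\le\hat p\,\epsilon$ and any vector $\mathbf{d}\in\mathbb{R}^{9\bar m+3n}$ such that $B+\operatorname{Diag}(\mathbf{d})+H\succeq 0$, one has $\operatorname{rank}(B+\operatorname{Diag}(\mathbf{d})+H)\ge 9\bar m+4$.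
   Context: All graphs are finite, undirected, simple and loopless; $\mathcal{V}(\cdot)$, $\mathcal{E}(\cdot)$ denote vertex and edge sets; a nonedge is a pair of distinct nonadjacent vertices. $\mathbb{S}^N$ is the space of real symmetric $N\times N$ matrices, $\succeq0$ means positive semidefinite, $\|\cdot\|_F$ is the Frobenius norm, $\operatorname{Diag}(\mathbf{d})$ is the diagonal matrix with diagonal $\mathbf{d}$. Graph construction. First form the Peeters supergraph $\mathcal{G}_1$ of $\mathcal{G}$: for each unordered pair of distinct vertices $i,j\in\mathcal{V}(\mathcal{G})$ (adjacent or not, listed in some fixed order $i,j$), add to $\mathcal{G}$ four new vertices $a_{ij},b_{ij},c_{ij},d_{ij}$ and the nine edges $\{i,a_{ij}\},\{i,b_{ij}\},\{a_{ij},b_{ij}\},\{j,c_{ij}\},\{j,d_{ij}\},\{c_{ij},d_{ij}\},\{a_{ij},j\},\{i,d_{ij}\},\{b_{ij},c_{ij}\}$. Then form $\mathcal{G}^*$ from $\mathcal{G}_1$ with robustness parameter $c=5$: replace every node of $\mathcal{G}_1$ by $3(c+1)$ nodes partitioned into three parts of size $c+1$ and connected as a complete 3-partite graph with these parts; pick one of the three parts of each gadget to be ''exposed''; for every edge $\{i,j\}$ of $\mathcal{G}_1$ join all $c+1$ exposed copies of $i$ to all $c+1$ exposed copies of $j$. Matrix construction. $$B=\begin{pmatrix} D & K^{\top} \\ K & A \end{pmatrix}.$$ Every vertex $i$ of $\mathcal{G}^*$ corresponds to three indices, with parent map $\pi$ sending each of the three to $i$. $A\in\mathbb{S}^{3n}$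 is given by $A(k,l)=2$ if $\{\pi(k),\pi(l)\}$ is a nonedge of $\mathcal{G}^*$; $A(k,l)=0$ if $\{\pi(k),\pi(l)\}\in\mathcal{E}(\mathcal{G}^* )$; $A(k,l)=1$ if $\pi(k)=\pi(l)$, $k\neq l$; $A(k,k)=0$. $K$ is $3n\times 9\bar m$, with one column $u$ for each unordered pair $\{k,l\}$ of indices such that $\{\pi(k),\pi(l)\}$ is a nonedge of $\mathcal{G}^*$ (nine per nonedge): $K(t,u)=s$ if $t\in\{k,l\}$ and $K(t,u)=s\delta$ otherwise. $D$ is the $9\bar m\times 9\bar m$ matrix with zero diagonal and all off-diagonal entries equal to $-2\hat p\epsilon$. *)

(* Defs.v *)
From HB Require Import structures.
From mathcomp Require Import all_boot all_order all_algebra.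
From mathcomp Require Import reals.
Set Implicit Arguments.
Unset Strict Implicit.
Unset Printing Implicit Defensive.
Import Order.TTheory GRing.Theory Num.Theory.

Record sgraph := SGraph {
  vertex :> finType;
  adj : rel vertex;
  adj_sym : symmetric adj;
  adj_irrefl : irreflexive adj
}.

Definition colorable (k : nat) (G : sgraph) : Prop :=
  exists f : G -> 'I_k, forall x y, adj x y -> f x != f y.

Definition nonedge (G : sgraph) (x y : G) : bool := (x != y) && ~~ adj x y.

Definition unordered_pairs (T : finType) (r : rel T) : {set {set T}} :=
  [set [set xy.1; xy.2] | xy : T * T & r xy.1 xy.2].

Definition nonedges (G : sgraph) : {set {set G}} :=
  unordered_pairs (@nonedge G).

(* [o i j] means that the pair {i, j} is listed in the order i, j: every
   unordered pair of distinct vertices is listed in exactly one order. *)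
Definition pair_listing (T : finType) (o : rel T) : Prop :=
  irreflexive o /\ forall i j, i != j -> o i j (+) o j i.

Section Peeters.

Variables (G : sgraph) (o : rel G).

(* The four vertices added for the pair {i, j} listed as p = (i, j) are
   inr (p, 0) = a_ij, inr (p, 1) = b_ij, inr (p, 2) = c_ij, inr (p, 3) = d_ij. *)
Definition peeters_vertex : finType := (G + {p : G * G | o p.1 p.2} * 'I_4)%type.

Definition peeters_arc (x y : peeters_vertex) : bool :=
  match x, y with
  | inl v, inl w => adj v w
  | inl v, inr (p, q) =>
      (v == (val p).1) && (val q \in [:: 0; 1; 3])
      || (v == (val p).2) && (val q \in [:: 0; 2; 3])
  | inr (p, q), inr (p', q') =>
      (p == p') && ((val q, val q') \in [:: (0, 1); (1, 2); (2, 3)])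
  | inr _, inl _ => false
  end.

Definition peeters_adj (x y : peeters_vertex) : bool :=
  peeters_arc x y || peeters_arc y x.

Fact peeters_adj_sym : symmetric peeters_adj.
Proof. by move=> x y; rewrite /peeters_adj orbC. Qed.

Fact peeters_adj_irrefl : irreflexive peeters_adj.
Proof.
move=> [v|[p q]]; rewrite /peeters_adj orbb /= ?adj_irrefl //.
by rewrite eqxx !inE !xpair_eqE; case: q => [[|[|[|[|q]]]]].
Qed.

Definition peeters : sgraph := SGraph peeters_adj_sym peeters_adj_irrefl.

End Peeters.

Section Robust.

(* The node (v, a, t) is the copy number t in the part a of the gadget of v. *)
Variables (G : sgraph) (c : nat) (exposed : G -> 'I_3).

Definition robust_vertex : finType := (G * 'I_3 * 'I_c.+1)%type.

Definition robust_adj (x y : robust_vertex) : bool :=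
  let: (v, a, _) := x in let: (w, b, _) := y in
  (v == w) && (a != b)
  || [&& adj v w, a == exposed v & b == exposed w].

Fact robust_adj_sym : symmetric robust_adj.
Proof.
move=> [[v a] t] [[w b] u] /=.
by rewrite eq_sym (eq_sym a) adj_sym [(_ == exposed v) && _]andbC.
Qed.

Fact robust_adj_irrefl : irreflexive robust_adj.
Proof. by move=> [[v a] t] /=; rewrite !eqxx adj_irrefl. Qed.

Definition robust : sgraph := SGraph robust_adj_sym robust_adj_irrefl.

End Robust.

Lemma card_unordered_pairs (T : finType) (r : rel T) :
  symmetric r -> irreflexive r ->
  #|[set xy : T * T | r xy.1 xy.2]| = 2 * #|unordered_pairs r|.
Proof.
move=> rS rI; set S := [set _ | _].
rewrite -sum1_card (partition_big (fun xy : T * T => [set xy.1; xy.2])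
  (mem (unordered_pairs r))) /=; last first.
  by move=> xy; rewrite inE => rxy; apply/imsetP; exists xy; rewrite ?inE.
rewrite mulnC -sum_nat_const; apply: eq_bigr => P /imsetP[[x y]].
rewrite inE /= => rxy ->{P}.
have nxy : x != y by apply: contraTneq rxy => ->; rewrite rI.
rewrite sum1_card (_ : 2 = #|[set (x, y); (y, x)]|); last first.
  by rewrite cards2 xpair_eqE negb_and nxy.
apply: eq_card => -[u v]; rewrite !inE unfold_in /= !inE /= !xpair_eqE.
apply/andP/orP => [[ruv /eqP E]|[] /andP[/eqP-> /eqP->]]; last 2 first.
- by [].
- by rewrite rS setUC.
have nuv : u != v by apply: contraTneq ruv => ->; rewrite rI.
have := set21 u v; have := set22 u v; rewrite E !inE.
by case/orP=> /eqP Ev; case/orP=> /eqP Eu; move: nuv; rewrite Eu Ev ?eqxx //;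
  [right|left].
Qed.

Section Indices.

Variable G : sgraph.

Fact parent_subproof (k : 'I_(3 * #|G|)) : k %/ 3 < #|G|.
Proof. by rewrite ltn_divLR // [(_ * 3)%N]mulnC ltn_ord. Qed.

Definition parent (k : 'I_(3 * #|G|)) : G :=
  enum_val (Ordinal (parent_subproof k)).

Definition index_pairs : {set {set 'I_(3 * #|G|)}} :=
  unordered_pairs (fun k l => nonedge (parent k) (parent l)).

Lemma card_parent (x : G) : #|[set k | parent k == x]| = 3.
Proof.
pose i := enum_rank x.
have lt (a : 'I_3) : 3 * i + a < 3 * #|G|.
  apply: (@leq_trans (3 * i.+1)); last by rewrite leq_mul2l ltn_ord.
  by rewrite mulnS addnC ltn_add2r.
rewrite -[RHS]card_ord -(card_imset _ (_ : injective (fun a => Ordinal (lt a)))).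
  apply: eq_card => k; rewrite !inE.
  apply/eqP/imsetP => [E|[a _ ->]].
    exists (Ordinal (ltn_pmod k (isT : 0 < 3))) => //; apply: val_inj => /=.
    have -> : i = Ordinal (parent_subproof k) by rewrite /i -E enum_valK.
    by rewrite /= [(3 * (_ %/ _))%N]mulnC -divn_eq.
  rewrite /parent -[RHS]enum_rankK; congr enum_val; apply: val_inj => /=.
  by rewrite [(3 * i)%N]mulnC divnMDl // divn_small ?addn0.
by move=> a b [] /addnI /val_inj.
Qed.

Lemma card_index_pairs : #|index_pairs| = 9 * #|nonedges G|.
Proof.
have nS : symmetric (@nonedge G).
  by move=> x y; rewrite /nonedge eq_sym adj_sym.
have nI : irreflexive (@nonedge G) by move=> x; rewrite /nonedge eqxx.
apply/eqP; rewrite -(@eqn_pmul2l 2) // mulnCA -!card_unordered_pairs //.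
rewrite -sum1_card (partition_big
  (fun kl : 'I_(3 * #|G|) * 'I_(3 * #|G|) => (parent kl.1, parent kl.2))
  (mem [set xy : G * G | nonedge xy.1 xy.2])) /=; last first.
  by move=> kl; rewrite !inE.
rewrite [(9 * _)%N]mulnC -sum_nat_const; apply/eqP; apply: eq_bigr => -[x y].
rewrite inE /= => nxy; rewrite sum1_card.
rewrite (_ : 9 = #|setX [set k | parent k == x] [set k | parent k == y]|).
  apply: eq_card => -[k l]; rewrite !inE unfold_in /= !inE /= xpair_eqE.
  by case: eqP => [->|_]; case: eqP => [->|_]; rewrite ?nxy ?andbF.
by rewrite cardsX !card_parent.
Qed.

Definition index_pair (u : 'I_(9 * #|nonedges G|)) : {set 'I_(3 * #|G|)} :=
  enum_val (cast_ord (esym card_index_pairs) u).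

End Indices.

Local Open Scope ring_scope.

Section Matrices.

Variables (R : realType) (G : sgraph).

Definition mxA : 'M[R]_(3 * #|G|) :=
  \matrix_(k, l)
    if k == l then 0
    else if parent k == parent l then 1
    else if adj (parent k) (parent l) then 0
    else 2.

Definition mxK (s delta : R) : 'M[R]_(3 * #|G|, 9 * #|nonedges G|) :=
  \matrix_(t, u) if t \in index_pair u then s else s * delta.

Definition mxD (eps phat : R) : 'M[R]_(9 * #|nonedges G|) :=
  \matrix_(u, v) if u == v then 0 else - 2 * phat * eps.

Definition mxB (s delta eps phat : R) :
    'M[R]_(9 * #|nonedges G| + 3 * #|G|) :=
  block_mx (mxD eps phat) (mxK s delta)^T (mxK s delta) mxA.

End Matrices.

Definition psd (R : realType) (N : nat) (M : 'M[R]_N) : Prop :=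
  M \is symmetricmx /\ forall x : 'cV[R]_N, 0 <= (x^T *m M *m x) 0 0.

Definition frobenius (R : realType) (N : nat) (M : 'M[R]_N) : R :=
  Num.sqrt (\sum_i \sum_j M i j ^+ 2).

(* Main.v *)
Require Import Defs.
From mathcomp Require Import all_boot all_order all_algebra.
From mathcomp Require Import reals.
From mathcomp Require Import ring lra.
Set Implicit Arguments.
Unset Strict Implicit.
Unset Printing Implicit Defensive.
Import Order.TTheory GRing.Theory Num.Theory.
Local Open Scope ring_scope.

(** Write the top left block of M = B + Diag(d) + H as P and eliminate it.
    A rank of M of at most 9m + 3 then means that the Schur complement of P has rank
    at most 3, that is, that it is the Gram matrix of vectors v_k of three-dimensional
    space, one for each of the three indices of every vertex of the robust graph.
    Outside the diagonal, this Gram matrix is A minus the matrix w of the products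
    L P^-1 L^T, where L is K up to a small error, and up to the small entries of H.

    If the graph is colourable, one can take v_k to be the unit vector of the colour
    of k.  The matrix P may be chosen as a diagonal matrix of order s^2 plus a
    constant matrix, so that its inverse is explicit, and its diagonal controls the
    nonedge entries of w one by one; see [low_rank_of_colorable].

    In the other direction ([colorable_of_low_rank]), P has negative off-diagonal
    entries, hence a nonnegative inverse ([stieltjes]), and w is nonnegative.  So
    distinct vectors have products of at most about 2, and in space only few of them
    can be long ([few_long_vectors]).  This bounds P^-1, and s can be taken so
    large that s^2 P^-1 is diagonal up to a negligible error ([inverse_weights]),
    say with entries y_u.  As K has entries s and s delta, one gets

      v_k . v_l = A(k,l) - y_kl (1 - delta)^2 - b_k - b_l,

    where y_kl = 0 unless k and l belong to a nonedge, and where b collects the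
    contributions of delta.  If all b vanished, then the v_k would be an orthogonal
    representation of the robust graph in which siblings (indices of the same
    vertex) have product 1.  The size of b is the crux, because a priori two
    long vectors can have a product of order - 1/delta^2 and with it a large y_kl.  Summing the
    identity over l shows, however, that up to small errors

      b_k = d |v_k|^2 - v_k . W - beta      with W = d (v_1 + ... + v_3n)

    for constants d (about delta) and beta, and summing again, that q = |W|^2 + 2 beta
    is at least d^2 times the sum of all |v_k|^2 ([slack_eq], [energy]).  Hence the
    shifted vectors X_k = v_k - W have products q and q + 1 on edges and siblings as
    long as the vectors are short; and if v_k is long, the products of v_k with the
    X_l of its siblings and neighbours are nearly constant, namely - d |v_k|^2.  After
    projection along v_k the matrix of products becomes I + (q - d^2 |v_k|^2) J with
    q - d^2 |v_k|^2 >= 0 up to small errors.  It is invertible although the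
    projected vectors lie in a plane, which is absurd: no vector is long
    ([two_long], [one_long], [no_long_vector]).  Then W and b are tiny, the vectors
    form a nearly orthonormal representation ([near_orthonormal]), and the gadget of
    Peeters forces any two vertices of the original graph to get nearly orthogonal or
    nearly parallel vectors ([gadget_dichotomy]).  The at most three directions are
    the colours ([color_by_direction]). *)

(** * Positive semidefinite matrices, Gram factorizations and Schur complements *)

Section PsdMatrices.
Variable R : realType.

Lemma symmetricmxP n (A : 'M[R]_n) : reflect (A^T = A) (A \is symmetricmx).
Proof.
apply: (iffP idP) => [|h].
  by move/is_hermitianmxP; rewrite /= expr0 scale1r => {2}->; rewrite map_mx_id.
by apply/is_hermitianmxP; rewrite /= expr0 scale1r map_mx_id ?h.
Qed.

Lemma psd_tr n (M : 'M[R]_n) : psd M -> M^T = M.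
Proof. by case=> /symmetricmxP. Qed.

Lemma addmxE m n (A B : 'M[R]_(m, n)) i j : (A + B) i j = A i j + B i j.
Proof. by rewrite mxE. Qed.

Lemma scalemxE m n a (A : 'M[R]_(m, n)) i j : (a *: A) i j = a * A i j.
Proof. by rewrite mxE. Qed.

Lemma submxE m n (A B : 'M[R]_(m, n)) i j : (A - B) i j = A i j - B i j.
Proof. by rewrite !mxE. Qed.

Local Notation basis_cV k := (delta_mx k (0 : 'I_1)).

Lemma quad_line n (M : 'M[R]_n) (x y : 'cV[R]_n) t : M^T = M ->
  ((x + t *: y)^T *m M *m (x + t *: y)) 0 0 =
  (x^T *m M *m x) 0 0 + 2 * t * (y^T *m M *m x) 0 0
    + t ^+ 2 * (y^T *m M *m y) 0 0.
Proof.
move=> MT.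
have C : (x^T *m M *m y) 0 0 = (y^T *m M *m x) 0 0.
  by rewrite -[y^T *m M *m x]trmxK [RHS]mxE !trmx_mul trmxK MT mulmxA.
have -> : (x + t *: y)^T = x^T + t *: y^T by rewrite linearD linearZ.
rewrite !mulmxDl !mulmxDr -!scalemxAl -!scalemxAr.
rewrite !(addmxE, scalemxE) C; ring.
Qed.

Lemma quad_delta n (M : 'M[R]_n) (x : 'cV[R]_n) k :
  ((basis_cV k)^T *m M *m x) 0 0 = (M *m x) k 0.
Proof. by rewrite trmx_delta -rowE -row_mul mxE. Qed.

Lemma quad_delta2 n (M : 'M[R]_n) k l :
  ((basis_cV k)^T *m M *m (basis_cV l)) 0 0 = M k l.
Proof. by rewrite quad_delta -colE mxE. Qed.

Lemma psd_diag_ge0 n (M : 'M[R]_n) k : psd M -> 0 <= M k k.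
Proof. by case=> _ /(_ (basis_cV k)); rewrite quad_delta2. Qed.

(** If the entry (k, l) did not vanish, then the form would be negative at a point of the
    line through e_l in the direction e_k. *)
Lemma psd_diag0 n (M : 'M[R]_n) : psd M -> (forall k, M k k = 0) -> M = 0.
Proof.
move=> Mp M0; apply/matrixP => k l; rewrite mxE; apply/eqP/contraT => Mkl.
have MT := psd_tr Mp.
case: Mp => _ /(_ (basis_cV l + (- (M k l)^-1) *: basis_cV k)).
rewrite quad_line // !quad_delta2 !M0 add0r mulr0 addr0 mulrN mulNr.
by rewrite -mulrA mulVf // mulr1; lra.
Qed.

(** Cholesky factorization by pivoting on a nonzero diagonal entry: each pivot
    lowers the rank, so that the number of columns needed is the rank. *)
Lemma psd_gram n (M : 'M[R]_n) r :
  psd M -> (\rank M <= r)%N -> exists V : 'M[R]_(n, r), M = V *m V^T.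
Proof.
elim: r M => [|r IH] M Mp.
  rewrite leqn0 mxrank_eq0 => /eqP ->; exists 0; by rewrite mul0mx.
have [->|M0] := eqVneq M 0; first by exists 0; rewrite mul0mx.
move=> rM; have MT := psd_tr Mp.
have [k Mk] : exists k, M k k != 0.
  apply/existsP; move: M0; apply: contraNT; rewrite negb_exists => /forallP h.
  by apply/eqP/psd_diag0 => // k; apply/eqP; rewrite -[_ == _]negbK.
have Mk0 : 0 < M k k by rewrite lt_def Mk psd_diag_ge0.
have rowT : row k M = (col k M)^T by rewrite tr_col MT.
pose S := M - (M k k)^-1 *: (col k M *m row k M).
have ST : S^T = S.
  by rewrite /S linearB linearZ /= trmx_mul !rowT trmxK MT.
have Sp : psd S.
  split; first exact/symmetricmxP.
  move=> x; case: Mp => _ /(_ (x + (- ((M *m x) k 0 / M k k)) *: basis_cV k)).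
  rewrite quad_line // quad_delta quad_delta2 /S mulmxBr mulmxBl.
  rewrite -scalemxAr -scalemxAl.
  have -> : x^T *m (col k M *m row k M) *m x = (x^T *m col k M) *m (row k M *m x).
    by rewrite !mulmxA.
  rewrite -row_mul.
  have -> : x^T *m col k M = (row k (M *m x))^T.
    by rewrite row_mul rowT trmx_mul trmxK.
  have -> : (M *m x) k 0 = row k (M *m x) 0 0 by rewrite [RHS]mxE.
  move: (row k _) => y h; rewrite submxE scalemxE.
  rewrite [(y^T *m y) 0 0]mxE big_ord1 [y^T _ _]mxE.
  apply: (le_trans h). rewrite le_eqVlt; apply/orP; left; apply/eqP.
  by field; exact: Mk.
have Se : S *m basis_cV k = 0.
  rewrite /S mulmxBl -scalemxAl -mulmxA -colE.
  have -> : row k M *m basis_cV k = (M k k)%:M.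
    by rewrite -colE; apply/matrixP => i j; rewrite !ord1 !mxE.
  by rewrite mul_mx_scalar scalerA mulVf // scale1r subrr.
have SM : (S <= M)%MS.
  rewrite /S addmx_sub ?submx_refl // eqmx_opp scalemx_sub //.
  by rewrite mulmx_sub // row_sub.
have rS : (\rank S < \rank M)%N.
  rewrite ltn_neqAle mxrankS // andbT.
  apply: contraNneq Mk => rE.
  have /submxP[D DE] : (M <= S)%MS by have := mxrank_leqif_sup SM; case=> _ <-; rewrite rE.
  have : (M *m basis_cV k) k 0 = 0 by rewrite {1}DE -mulmxA Se mulmx0 mxE.
  by rewrite -colE mxE => ->.
have [V VE] := IH S Sp (leq_trans rS rM : (\rank S <= r)%N).
pose W : 'M_(n, 1 + r) := row_mx (Num.sqrt (M k k)^-1 *: col k M) V.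
suff : M = W *m W^T by exists W.
rewrite tr_row_mx mul_row_col -VE linearZ /= -scalemxAl -scalemxAr scalerA.
rewrite -expr2 sqr_sqrtr ?invr_ge0 ?ltW // -rowT /S.
by rewrite addrCA subrr addr0.
Qed.

Lemma gram_diag_ge0 m n (x : 'M[R]_(m, n)) i : 0 <= (x *m x^T) i i.
Proof.
rewrite mxE; apply: sumr_ge0 => j _; rewrite !mxE; exact: sqr_ge0.
Qed.

Lemma gram_eq0 n (x : 'rV[R]_n) : (x *m x^T) 0 0 = 0 -> x = 0.
Proof.
rewrite mxE => /eqP; rewrite psumr_eq0 => [|j _]; last first.
  by rewrite mxE; exact: sqr_ge0.
move/allP => h; apply/matrixP => i j; rewrite !ord1 mxE.
have := h j (mem_index_enum _); rewrite /= mxE mulf_eq0 orbb.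
by move/eqP.
Qed.

Lemma psd_ker n (M : 'M[R]_n) (x : 'cV[R]_n) :
  psd M -> (x^T *m M *m x) 0 0 = 0 -> M *m x = 0.
Proof.
move=> Mp; have [V ->] := psd_gram Mp (rank_leq_row M).
rewrite mulmxA -mulmxA => h.
suff /(congr1 trmx) : x^T *m V = 0.
  by rewrite trmx_mul trmxK -mulmxA => ->; rewrite trmx0 mulmx0.
by apply: gram_eq0; rewrite trmx_mul trmxK.
Qed.

(** Block Gaussian elimination, read as an identity of quadratic forms. *)
Lemma schur_factor p q (P : 'M[R]_p) (L : 'M[R]_(q, p)) (Z : 'M[R]_q) :
  P \in unitmx -> P^T = P ->
  let U := block_mx 1%:M (invmx P *m L^T) 0 1%:M in
  block_mx P L^T L Z =
    U^T *m block_mx P 0 0 (Z - L *m invmx P *m L^T) *m U.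
Proof.
move=> Pu PT U; rewrite /U tr_block_mx !trmx1 trmx0 trmx_mul trmxK trmx_inv PT.
rewrite !mulmx_block !mul1mx !mulmx1 !mul0mx !mulmx0 !addr0 ?add0r.
by rewrite mulmxKV // !mulmxA mulmxV // mul1mx addrCA subrr addr0.
Qed.

Lemma schur_unit p q (P : 'M[R]_p) (L : 'M[R]_(q, p)) :
  block_mx 1%:M (invmx P *m L^T) 0 1%:M \in unitmx.
Proof. by rewrite unitmxE det_ublock !det1 mulr1 unitr1. Qed.

Lemma schur_rank p q (P : 'M[R]_p) (L : 'M[R]_(q, p)) (Z : 'M[R]_q) :
  P \in unitmx -> P^T = P ->
  \rank (block_mx P L^T L Z) = (p + \rank (Z - L *m invmx P *m L^T)%R)%N.
Proof.
move=> Pu PT; rewrite schur_factor //.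
rewrite mxrankMfree ?row_free_unit ?schur_unit //.
rewrite -[LHS]mxrank_tr trmx_mul trmxK.
rewrite mxrankMfree ?row_free_unit ?schur_unit //.
by rewrite mxrank_tr rank_diag_block_mx mxrank_unit.
Qed.

Lemma psd_congr n m (M : 'M[R]_n) (U : 'M[R]_(n, m)) :
  psd M -> psd (U^T *m M *m U).
Proof.
case=> /symmetricmxP MT Mp; split.
  by apply/symmetricmxP; rewrite !trmx_mul trmxK MT mulmxA.
by move=> x; have := Mp (U *m x); rewrite trmx_mul !mulmxA.
Qed.

Lemma psd_diag_block p q (P : 'M[R]_p) (S : 'M[R]_q) :
  psd (block_mx P 0 0 S) <-> psd P /\ psd S.
Proof.
split=> [[/symmetricmxP] | [[/symmetricmxP PT Pp] [/symmetricmxP ST Sp]]].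
  rewrite tr_block_mx !trmx0 => /eq_block_mx[PT _ _ ST] h.
  split; split; try exact/symmetricmxP.
    move=> x; have := h (col_mx x 0); rewrite tr_col_mx mul_row_block mul_row_col.
    by rewrite !(mulmx0, mul0mx, trmx0, addr0).
  move=> x; have := h (col_mx 0 x); rewrite tr_col_mx mul_row_block mul_row_col.
  by rewrite !(mulmx0, mul0mx, trmx0, addr0, add0r).
split; first by apply/symmetricmxP; rewrite tr_block_mx !trmx0 PT ST.
move=> x; rewrite -[x]vsubmxK tr_col_mx mul_row_block mul_row_col.
by rewrite !(mulmx0, addr0, add0r) mxE addr_ge0.
Qed.

Lemma psd_schur p q (P : 'M[R]_p) (L : 'M[R]_(q, p)) (Z : 'M[R]_q) :
  P \in unitmx -> P^T = P ->
  psd (block_mx P L^T L Z) <-> psd P /\ psd (Z - L *m invmx P *m L^T).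
Proof.
move=> Pu PT; rewrite -psd_diag_block schur_factor //.
set U := block_mx 1%:M _ _ _; have Uu : U \in unitmx by exact: schur_unit.
split=> [h|]; last exact: psd_congr.
have := psd_congr (invmx U) h; rewrite !mulmxA mulmxK //.
by rewrite -trmx_mul mulmxV // trmx1 mul1mx.
Qed.

End PsdMatrices.

(** * Matrices with nonpositive off-diagonal entries *)

Section ZMatrices.
Variable R : realType.

Lemma quadE n (M : 'M[R]_n) (x y : 'cV[R]_n) :
  (x^T *m M *m y) 0 0 = \sum_i \sum_j x i 0 * M i j * y j 0.
Proof.
rewrite -mulmxA mxE; apply: eq_bigr => i _; rewrite !mxE mulr_sumr.
by apply: eq_bigr => j _; rewrite mulrA.
Qed.

(** When the off-diagonal entries of P are nonpositive, replacing a vector by its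
    absolute values can only decrease the quadratic form, so a singular P would
    have a nonnegative kernel vector; a positive L does not annihilate it, whereas
    a kernel vector of the corner of a psd matrix annihilates the whole matrix. *)
Lemma corner_unit p q (P : 'M[R]_p) (L : 'M[R]_(q, p)) (Z : 'M[R]_q) :
  (0 < q)%N -> psd (block_mx P L^T L Z) ->
  (forall u v, u != v -> P u v <= 0) -> (forall k u, 0 < L k u) ->
  P \in unitmx.
Proof.
move=> q0 Mp Pneg Lpos; rewrite unitmxE unitfE; apply/det0P => -[v v0 vP].
have MT := psd_tr Mp.
have PT : P^T = P by move: MT; rewrite tr_block_mx => /eq_block_mx[].
pose z : 'cV[R]_p := \col_i `|v 0 i|.
have Pform (x : 'cV[R]_p) : ((col_mx x 0)^T *m block_mx P L^T L Z *m col_mx x (0 : 'cV_q)) 0 0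
     = (x^T *m P *m x) 0 0.
  rewrite tr_col_mx mul_row_block mul_row_col.
  by rewrite !(mulmx0, mul0mx, trmx0, addr0).
have zPz : (z^T *m P *m z) 0 0 = 0.
  apply/eqP; rewrite eq_le -{2}Pform; case: (Mp) => _ ->; rewrite andbT.
  have <- : (v^T^T *m P *m v^T) 0 0 = 0 by rewrite trmxK vP mul0mx mxE.
  rewrite !quadE; apply: ler_sum => i _; apply: ler_sum => j _; rewrite !mxE.
  have [->|ij] := eqVneq i j.
    move: (v 0 j) (P j j) => a b.
    by rewrite mulrAC [leRHS]mulrAC -normrM ger0_norm // -expr2 sqr_ge0.
  have := Pneg _ _ ij; move: (v 0 i) (v 0 j) (P i j) => a b c c0.
  rewrite mulrAC [leRHS]mulrAC -normrM; apply: ler_wnM2r => //.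
  exact: ler_norm.
have := psd_ker Mp (etrans (Pform z) zPz).
rewrite mul_block_col !mulmx0 !addr0 => /(congr1 dsubmx).
rewrite col_mxKd => /matrixP /(_ (Ordinal q0) 0); rewrite !mxE => /eqP.
rewrite psumr_eq0 => [/allP h|j _]; last first.
  by rewrite mxE mulr_ge0 // ltW // mxE.
case/negP: v0; apply/eqP/matrixP => i j; rewrite ord1 mxE.
have := h j (mem_index_enum _); rewrite !mxE /= mulf_eq0.
have := Lpos (Ordinal q0) j; rewrite ?mxE => L0; rewrite gt_eqF //= normr_eq0.
by move/eqP.
Qed.

(** Stieltjes: test the column x of the inverse against its negative part n; as
    n and the positive part have disjoint supports, the form of n is at most
    - n_j, which is nonpositive. *)
Lemma stieltjes n (P : 'M[R]_n) : psd P -> P \in unitmx ->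
  (forall u v, u != v -> P u v <= 0) -> forall i j, 0 <= invmx P i j.
Proof.
move=> Pp Pu Pneg i j.
pose x : 'cV[R]_n := col j (invmx P).
have Px : P *m x = delta_mx j 0 by rewrite /x !colE mulmxA mulmxV // mul1mx.
pose y : 'cV[R]_n := \col_k Num.max (- x k 0) 0.
have y0 k : 0 <= y k 0 by rewrite mxE le_max lexx orbT.
have nPx : (y^T *m P *m x) 0 0 = y j 0.
  by rewrite -mulmxA Px -colE !mxE.
have nPn : (y^T *m P *m y) 0 0 = 0.
  apply/eqP; rewrite eq_le; case: (Pp) => _ ->; rewrite andbT.
  suff : (y^T *m P *m y) 0 0 <= - (y^T *m P *m x) 0 0.
    by rewrite nPx => /le_trans; apply; rewrite oppr_le0.
  rewrite !quadE -sumrN; apply: ler_sum => k _; rewrite -sumrN.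
  apply: ler_sum => l _.
  have [->|kl] := eqVneq k l.
    have : y l 0 * (y l 0 + x l 0) = 0.
      rewrite mxE; case: (leP (- x l 0) 0) => ?; first by rewrite mul0r.
      by rewrite addNr mulr0.
    have := psd_diag_ge0 l Pp; nra.
  have yx : 0 <= y l 0 + x l 0.
    by rewrite mxE; case: (leP (- x l 0) 0) => ?; lra.
  have Pkl : 0 <= - P k l by rewrite oppr_ge0 Pneg.
  have := mulr_ge0 (mulr_ge0 (y0 k) Pkl) yx; lra.
have := psd_ker Pp nPn => Py.
have yz : y = 0 by rewrite -[y]mul1mx -(mulVmx Pu) -mulmxA Py mulmx0.
have : - x i 0 <= y i 0 by rewrite [y _ _]mxE le_max lexx.
by rewrite yz !mxE oppr_le0.
Qed.

End ZMatrices.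

(** * Scalar products and near-orthogonality in space *)

Section Dot.
Variables (R : realType) (d : nat).
Implicit Types u v w : 'rV[R]_d.

Definition dot u v : R := (u *m v^T) 0 0.

Lemma dotE u v : dot u v = \sum_a u 0 a * v 0 a.
Proof. by rewrite /dot mxE; apply: eq_bigr => a _; rewrite mxE. Qed.

Lemma dotC u v : dot u v = dot v u.
Proof. by rewrite !dotE; apply: eq_bigr => a _; rewrite mulrC. Qed.

Lemma dotDl u v w : dot (u + v) w = dot u w + dot v w.
Proof. by rewrite /dot mulmxDl mxE. Qed.

Lemma dotZl a u v : dot (a *: u) v = a * dot u v.
Proof. by rewrite /dot -scalemxAl mxE. Qed.

Lemma dotNl u v : dot (- u) v = - dot u v.
Proof. by rewrite -scaleN1r dotZl mulN1r. Qed.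

Lemma dotBl u v w : dot (u - v) w = dot u w - dot v w.
Proof. by rewrite dotDl dotNl. Qed.

Lemma dotDr u v w : dot u (v + w) = dot u v + dot u w.
Proof. by rewrite dotC dotDl !(dotC _ u). Qed.

Lemma dotZr a u v : dot u (a *: v) = a * dot u v.
Proof. by rewrite dotC dotZl dotC. Qed.

Lemma dotBr u v w : dot u (v - w) = dot u v - dot u w.
Proof. by rewrite dotC dotBl !(dotC _ u). Qed.

Lemma dot_sumr (I : Type) (r : seq I) (P : pred I) u (F : I -> 'rV[R]_d) :
  dot u (\sum_(i <- r | P i) F i) = \sum_(i <- r | P i) dot u (F i).
Proof.
apply: (big_morph (dot u)) => [x y|]; first exact: dotDr.
by rewrite /dot trmx0 mulmx0 mxE.
Qed.

Lemma dot_suml (I : Type) (r : seq I) (P : pred I) u (F : I -> 'rV[R]_d) :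
  dot (\sum_(i <- r | P i) F i) u = \sum_(i <- r | P i) dot (F i) u.
Proof. by rewrite dotC dot_sumr; apply: eq_bigr => i _; rewrite dotC. Qed.

Lemma dot_ge0 u : 0 <= dot u u.
Proof. exact: gram_diag_ge0. Qed.

Lemma dot_eq0 u : dot u u = 0 -> u = 0.
Proof. exact: gram_eq0. Qed.

Lemma cauchy u v : dot u v ^+ 2 <= dot u u * dot v v.
Proof.
have [v0|v0] := eqVneq (dot v v) 0.
  rewrite v0 mulr0 (dot_eq0 v0); suff -> : dot u 0 = 0 by rewrite expr0n.
  by rewrite /dot trmx0 mulmx0 mxE.
have vp : 0 < dot v v by rewrite lt_def v0 dot_ge0.
have := dot_ge0 (dot v v *: u - dot u v *: v).
rewrite !(dotBl, dotBr, dotZl, dotZr) (dotC v u) => h.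
rewrite -(ler_pM2l vp); lra.
Qed.

Lemma dot_mulmx m n (A : 'M[R]_(m, d)) (B : 'M[R]_(n, d)) i j :
  (A *m B^T) i j = dot (row i A) (row j B).
Proof.
by rewrite dotE mxE; apply: eq_bigr => a _; rewrite !mxE.
Qed.

Lemma trace_bound (I : finType) (P : pred I) (u : I -> 'rV[R]_d) :
  (\sum_(i | P i) dot (u i) (u i)) ^+ 2 <=
    d%:R * \sum_(i | P i) \sum_(j | P j) dot (u i) (u j) ^+ 2.
Proof.
pose g a b := \sum_(i | P i) u i 0 a * u i 0 b.
have -> : \sum_(i | P i) \sum_(j | P j) dot (u i) (u j) ^+ 2 =
          \sum_a \sum_b g a b ^+ 2.
  transitivity (\sum_(i | P i) \sum_(j | P j) \sum_a \sum_b
      (u i 0 a * u i 0 b) * (u j 0 a * u j 0 b)).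
    apply: eq_bigr => i _; apply: eq_bigr => j _.
    rewrite dotE expr2 big_distrlr /=.
    by apply: eq_bigr => a _; apply: eq_bigr => b _; rewrite mulrACA.
  transitivity (\sum_(i | P i) \sum_a \sum_b (u i 0 a * u i 0 b) * g a b).
    apply: eq_bigr => i _; rewrite exchange_big; apply: eq_bigr => a _.
    rewrite exchange_big; apply: eq_bigr => b _.
    by rewrite /g mulr_sumr.
  rewrite exchange_big; apply: eq_bigr => a _.
  rewrite exchange_big; apply: eq_bigr => b _.
  by rewrite -mulr_suml expr2.
have -> : \sum_(i | P i) dot (u i) (u i) = \sum_a g a a.
  rewrite /g exchange_big; apply: eq_bigr => i _; exact: dotE.
pose gd : 'rV[R]_d := \row_a g a a; pose one : 'rV[R]_d := const_mx 1.
have -> : \sum_a g a a = dot one gd.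
  by rewrite dotE; apply: eq_bigr => a _; rewrite !mxE mul1r.
apply: le_trans (cauchy _ _) _.
have -> : dot one one = d%:R.
  rewrite dotE (eq_bigr (fun=> 1)) => [|a _]; last by rewrite !mxE mulr1.
  by rewrite sumr_const card_ord.
apply: ler_wpM2l; first exact: ler0n.
rewrite dotE; apply: ler_sum => a _; rewrite !mxE -expr2 (bigD1 a) //= lerDl.
by apply: sumr_ge0 => b _; exact: sqr_ge0.
Qed.

End Dot.

Section Geometry.
Variable R : realType.
Implicit Types u v w : 'rV[R]_3.

(** Long vectors that make no substantially acute angle: after normalization,
    all entries x of the Gram matrix satisfy x^2 <= - x + 1/10 off the diagonal,
    whereas its sum is nonnegative, so its Frobenius norm is too small for a
    matrix of rank 3 with that trace. *)
Lemma few_long_vectors (I : finType) (P : pred I) (u : I -> 'rV[R]_3) :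
  (forall i, P i -> 60 < dot (u i) (u i)) ->
  (forall i j, P i -> P j -> i != j -> dot (u i) (u j) <= 3) ->
  (#|P| <= 8)%N.
Proof.
move=> long acute.
pose w i := (Num.sqrt (dot (u i) (u i)))^-1 *: u i.
have ww i : P i -> dot (w i) (w i) = 1.
  move=> Pi; rewrite dotZl dotZr mulrA -expr2 exprVn sqr_sqrtr ?dot_ge0 //.
  by rewrite mulVf // gt_eqF // (lt_trans _ (long i Pi)).
have wle i j : P i -> P j -> i != j -> dot (w i) (w j) <= 1 / 20.
  move=> Pi Pj ij; rewrite dotZl dotZr mulrA -invfM.
  set q := Num.sqrt _ * _.
  have q60 : 60 <= q.
    have -> : 60 = Num.sqrt (60 ^+ 2) :> R by rewrite sqrtr_sqr ger0_norm.
    rewrite /q -sqrtrM ?dot_ge0 // ler_wsqrtr // expr2.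
    by rewrite ler_pM // ltW //; exact: long.
  have q0 : 0 < q by lra.
  by rewrite mulrC ler_pdivrMr //; have := acute i j Pi Pj ij; lra.
have N1 : \sum_(i | P i) dot (w i) (w i) = #|P|%:R.
  by rewrite (eq_bigr (fun=> 1)) ?sumr_const // => i; exact: ww.
have := trace_bound P w; rewrite N1.
have ub : \sum_(i | P i) \sum_(j | P j) dot (w i) (w j) ^+ 2 <=
    2 * #|P|%:R + #|P|%:R ^+ 2 / 10.
  have h0 := dot_ge0 (\sum_(i | P i) w i).
  apply: (@le_trans _ _ (\sum_(i | P i) \sum_(j | P j)
     (- dot (w i) (w j) + 1 / 10 + 2 * (i == j)%:R))).
    apply: ler_sum => i Pi; apply: ler_sum => j Pj.
    have [<-|ij] := eqVneq i j; first by rewrite ww //= mulr1n; lra.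
    have h1 := wle i j Pi Pj ij; rewrite /= mulr0n.
    have h2 : -1 <= dot (w i) (w j).
      have := dot_ge0 (w i + w j).
      rewrite !(dotDl, dotDr) ww // ww // (dotC (w j)); lra.
    move: (dot (w i) (w j)) h1 h2 => x h1 h2.
    have [x0|x0] := leP x 0; nra.
  have -> : \sum_(i | P i) \sum_(j | P j)
     (- dot (w i) (w j) + 1 / 10 + 2 * (i == j)%:R) =
     - dot (\sum_(i | P i) w i) (\sum_(i | P i) w i)
     + #|P|%:R ^+ 2 / 10 + 2 * #|P|%:R.
    rewrite dot_suml -sumrN.
    transitivity (\sum_(i | P i) (- dot (w i) (\sum_(j | P j) w j)
        + #|P|%:R * (1 / 10 : R) + 2)).
      apply: eq_bigr => i Pi; rewrite !big_split /= dot_sumr sumrN.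
      rewrite sumr_const -mulr_sumr -[_ *+ #|P|]mulr_natl; congr (_ + _).
      rewrite (bigD1 i) //= eqxx big1 ?addr0 ?mulr1 // => j /andP[_].
      by rewrite eq_sym => /negbTE->.
    rewrite !big_split /= !sumr_const; congr (_ + _ + _); last by ring.
    by rewrite -[LHS]mulr_natl; field.
  lra.
move=> tr; have : #|P|%:R ^+ 2 <= 3 * (2 * #|P|%:R + #|P|%:R ^+ 2 / 10) :> R.
  by apply: le_trans tr _; rewrite ler_wpM2l.
rewrite leqNgt => h; apply/negP => P9.
have : 9%:R <= #|P|%:R :> R by rewrite ler_nat.
move: (#|P|%:R) h => x; nra.
Qed.

(** A matrix close to I + k J with k >= 0 is invertible, however large k is. *)
Lemma near_I_plus_J N (M : 'M[R]_N) k e :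
  0 <= k -> N%:R * e < 1 ->
  (forall i j, `|M i j - ((i == j)%:R + k)| <= e) -> M \in unitmx.
Proof.
move=> k0 Ne hM; rewrite unitmxE unitfE; apply/det0P => -[x x0 xM].
case/negP: x0; apply/eqP/dot_eq0/eqP; rewrite eq_le dot_ge0 andbT.
have : (x *m M *m x^T) 0 0 = 0 by rewrite xM mul0mx mxE.
rewrite mxE; under eq_bigr => j _ do rewrite !mxE mulr_suml.
move=> E0.
have : \sum_j \sum_i ((i == j)%:R * x 0 i * x 0 j + k * (x 0 i * x 0 j)
       - e * ((x 0 i ^+ 2 + x 0 j ^+ 2) / 2)) <= 0.
  rewrite -[leRHS]E0; apply: ler_sum => j _; apply: ler_sum => i _.
  have := hM i j; rewrite ler_norml => /andP[h1 h2].
  move: (M i j) (x 0 i) (x 0 j) ((i == j)%:R) h1 h2 => m a b c h1 h2.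
  have [ab|ab] := leP 0 (a * b).
    have : (a * b) * (- e) <= (a * b) * (m - (c + k)) by rewrite ler_wpM2l.
    have : 0 <= e by lra.
    have := sqr_ge0 (a - b); nra.
  have : (- (a * b)) * (m - (c + k)) <= (- (a * b)) * e.
    by rewrite ler_wpM2l // oppr_ge0 ltW.
  have : 0 <= e by lra.
  have := sqr_ge0 (a + b); nra.
rewrite (_ : \sum_j _ = dot x x + k * (\sum_i x 0 i) ^+ 2 - e * (N%:R * dot x x)).
  have := sqr_ge0 (\sum_i x 0 i); have := dot_ge0 x; nra.
transitivity (\sum_j (x 0 j * x 0 j + k * ((\sum_i x 0 i) * x 0 j)
   - e * ((dot x x + N%:R * x 0 j ^+ 2) / 2))).
  apply: eq_bigr => j _; rewrite sumrB big_split /= -!mulr_sumr -!mulr_suml.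
  congr (_ + _ - e * (_ / _)); last first.
    rewrite big_split /= sumr_const card_ord -[_ *+ N]mulr_natl dotE.
    by rewrite (eq_bigr (fun i => x 0 i * x 0 i)).
  rewrite (bigD1 j) //= eqxx mul1r big1 ?addr0 // => i /negbTE->.
  by rewrite !mul0r.
rewrite sumrB big_split /= -!mulr_sumr -!mulr_suml -dotE -expr2.
congr (_ - e * _); rewrite big_split /= sumr_const card_ord -mulr_sumr.
rewrite -[_ *+ N]mulr_natl; have -> : \sum_i x 0 i ^+ 2 = dot x x by rewrite dotE.
lra.
Qed.

(** Projecting out r orthogonal directions of space leaves room for only 3 - r
    independent vectors. *)
Lemma projected_gram r N (f : 'I_r -> 'rV[R]_3) (X X' : 'I_N -> 'rV[R]_3) k e :
  (forall a, 0 < dot (f a) (f a)) ->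
  (forall a b, a != b -> dot (f a) (f b) = 0) ->
  (3 < N + r)%N -> 0 <= k -> N%:R * e < 1 ->
  ~ forall i j, `|dot (X i) (X' j)
      - \sum_a dot (f a) (X i) * dot (f a) (X' j) / dot (f a) (f a)
      - ((i == j)%:R + k)| <= e.
Proof.
move=> f0 fo Nr k0 Ne h.
pose Y i := X i - \sum_a (dot (f a) (X i) / dot (f a) (f a)) *: f a.
pose YM : 'M_(N, 3) := \matrix_(i < N) Y i.
pose XM : 'M_(N, 3) := \matrix_(i < N) X' i.
pose F : 'M_(r, 3) := \matrix_(i < r) f i.
have Fr : row_free F.
  rewrite -kermx_eq0; apply/eqP/row_matrixP => i; rewrite row0.
  set x := row i _; have xF : x *m F = 0 by rewrite /x -row_mul mulmx_ker row0.
  apply/matrixP => b a; rewrite ord1 [RHS]mxE {b}.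
  have : (x *m F *m F^T) 0 a = 0 by rewrite xF mul0mx mxE.
  rewrite -mulmxA mxE (bigD1 a) //= big1 => [|b ba]; last first.
    by rewrite dot_mulmx !rowK fo // mulr0.
  rewrite addr0 dot_mulmx !rowK => /eqP; rewrite mulf_eq0 (gt_eqF (f0 a)) orbF.
  by move/eqP.
have YF : YM *m F^T = 0.
  apply/matrixP => i a; rewrite dot_mulmx !rowK mxE /Y dotBl dot_suml.
  rewrite (bigD1 a) //= big1 => [|b ba]; last by rewrite dotZl (fo _ _ ba) mulr0.
  by rewrite addr0 dotZl divfK ?gt_eqF // dotC subrr.
have := mulmx0_rank_max YF; rewrite mxrank_tr (eqP Fr) => rY.
have Mu : YM *m XM^T \in unitmx.
  apply: (near_I_plus_J k0 Ne) => i j; rewrite dot_mulmx !rowK /Y dotBl dot_suml.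
  have := h i j; congr (`|_ - _ - _| <= _); apply: eq_bigr => a _.
  by rewrite dotZl mulrAC.
have := mxrankM_maxl YM XM^T; rewrite (mxrank_unit Mu) => NY.
by move: Nr; rewrite ltnNge => /negP; apply; rewrite (leq_trans _ rY) // leq_add2r.
Qed.

(** An approximate Parseval identity in a basis x with approximate dual basis x'.
    It is exact with the inverse of the matrix of products, which is within 6 e
    of the identity. *)
Lemma near_parseval (x x' : 'I_3 -> 'rV[R]_3) e u w :
  e <= 1 / 6 -> (forall i j, `|dot (x i) (x' j) - (i == j)%:R| <= e) ->
  `|dot u w - \sum_i dot u (x' i) * dot (x i) w| <=
     6 * e * (\sum_i `|dot u (x' i)|) * (\sum_i `|dot (x i) w|).
Proof.
move=> e6 hx.
pose X : 'M_3 := \matrix_(i < 3) x i; pose X' : 'M_3 := \matrix_(i < 3) x' i.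
pose A := X *m X'^T.
have AE i j : A i j = dot (x i) (x' j) by rewrite dot_mulmx !rowK.
have Au : A \in unitmx.
  apply: (@near_I_plus_J _ _ 0 e) => //; first by lra.
  by move=> i j; rewrite AE addr0.
pose B := invmx A.
have BE : B = 1%:M - (A - 1%:M) *m B.
  by rewrite mulmxBl mul1mx mulmxV // opprB addrCA subrr addr0.
pose m := \big[Num.max/0]_i \big[Num.max/0]_j `|B i j|.
have Bm i j : `|B i j| <= m.
  apply: le_trans (le_bigmax _ _ i); exact: (le_bigmax _ (fun j => `|B i j|) j).
have e0 : 0 <= e := le_trans (normr_ge0 _) (hx 0 0).
have m0 : 0 <= m by apply: bigmax_ge_id.
have EB i j : `|((A - 1%:M) *m B) i j| <= 3 * e * m.
  rewrite mxE; apply: le_trans (ler_norm_sum _ _ _) _.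
  apply: (@le_trans _ _ (\sum_(l < 3) e * m)).
    apply: ler_sum => l _; rewrite normrM ler_pM //; by rewrite submxE AE mxE.
  by rewrite sumr_const card_ord; rewrite -[_ *+ _]mulr_natl; lra.
have m1 : m <= 1 + 3 * e * m.
  have h0 : 0 <= 1 + 3 * e * m by nra.
  apply: bigmax_le => // i _; apply: bigmax_le => // j _.
  rewrite BE submxE; apply: le_trans (ler_normB _ _) _; rewrite lerD //.
  by rewrite mxE normr_nat; case: eqP.
have m2 : m <= 2 by nra.
have BI i j : `|B i j - (i == j)%:R| <= 6 * e.
  rewrite BE submxE [1%:M _ _]mxE [X in `|X|]addrAC subrr sub0r normrN.
  by apply: le_trans (EB i j) _; nra.
have id1 : X'^T *m B *m X = 1%:M.
  by apply: mulmx1C; rewrite mulmxA mulmxV.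
have -> : dot u w = \sum_i \sum_j dot u (x' i) * B i j * dot (x j) w.
  rewrite /dot -[u in LHS]mulmx1 -id1 !mulmxA -mulmxA mxE.
  under eq_bigr => j _ do rewrite mxE mulr_suml.
  rewrite exchange_big; apply: eq_bigr => i _; apply: eq_bigr => j _.
  congr (_ * _ * _); first by rewrite dot_mulmx row_id rowK.
  by rewrite dot_mulmx row_id rowK.
have -> : \sum_i dot u (x' i) * dot (x i) w =
   \sum_i \sum_j dot u (x' i) * (i == j)%:R * dot (x j) w.
  apply: eq_bigr => i _; rewrite (bigD1 i) //= eqxx mulr1 big1 ?addr0 // => j.
  by rewrite eq_sym => /negbTE->; rewrite mulr0 mul0r.
rewrite -sumrB; under eq_bigr => i _ do rewrite -sumrB.
apply: le_trans (ler_norm_sum _ _ _) _.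
rewrite -mulrA big_distrlr mulr_sumr /=; apply: ler_sum => i _.
apply: le_trans (ler_norm_sum _ _ _) _; rewrite mulr_sumr; apply: ler_sum => j _.
rewrite -mulrBl -mulrBr !normrM mulrA; apply: ler_wpM2r => //.
by rewrite mulrC; apply: ler_wpM2r.
Qed.

End Geometry.

(** * Scalar estimates for projections *)

Section Scalar.
Variable R : realType.

Lemma normM_le (a b x y : R) : `|a| <= x -> `|b| <= y -> `|a * b| <= x * y.
Proof. by move=> ha hb; rewrite normrM ler_pM. Qed.

(** The entries of the Gram matrix after a projection along a vector of squared norm
    p, whose products with the given vectors are - d p up to bounded errors e1, e2:
    the errors only matter divided by p or multiplied by d. *)
Lemma project_one (p q d e1 e2 eta : R) :
  10 ^+ 12 <= p -> 0 < d -> d <= eta -> eta * (10 ^+ 9) <= 1 / 100 ->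
  `|e1| <= 10 ^+ 5 -> `|e2| <= 10 ^+ 5 ->
  d ^+ 2 * p - eta <= q ->
  `|q - (- (d * p) + e1) * (- (d * p) + e2) / p
      - Num.max 0 (q - d ^+ 2 * p)| <= 1 / 5.
Proof.
move=> hp d0 de he h1 h2 hq.
have p0 : 0 < p by lra.
have A : (- (d * p) + e1) * (- (d * p) + e2) / p =
  d ^+ 2 * p - d * (e1 + e2) + e1 * e2 / p by field; rewrite gt_eqF.
have B : `|e1 * e2 / p| <= 1 / 100.
  rewrite normrM normfV (ger0_norm (ltW p0)) ler_pdivrMr //.
  by apply: le_trans (normM_le h1 h2) _; lra.
have C : `|d * (e1 + e2)| <= 1 / 100.
  apply: (@le_trans _ _ (eta * (10 ^+ 5 + 10 ^+ 5))); last by lra.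
  apply: normM_le; first by rewrite ger0_norm // ltW.
  by apply: le_trans (ler_normD _ _) _; rewrite lerD.
move: B C; rewrite A !ler_norml => /andP[B1 B2] /andP[C1 C2].
by case: (leP 0 (q - d ^+ 2 * p)) => h; apply/andP; split; lra.
Qed.

(** The same for two vectors of squared norms p' <= p and product w: p0 is the squared
    norm of the second one after it has been made orthogonal to the first. *)
Lemma project_two (p p' w q d e1 e2 f1 f2 eta : R) :
  let p0 := p' - w ^+ 2 / p in
  10 ^+ 8 <= p' -> p' <= p -> w ^+ 2 <= 400 * p ->
  0 < d -> d <= eta -> eta * (10 ^+ 6) <= 1 -> d * `|w| <= 245 ->
  `|e1| <= 184 -> `|e2| <= 184 -> `|f1| <= 184 -> `|f2| <= 184 ->
  d ^+ 2 * (p + p') - eta <= q ->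
  `|q - (- (d * p) + e1) * (- (d * p) + e2) / p
      - (- (d * (p' - w)) + (f1 - w / p * e1)) *
        (- (d * (p' - w)) + (f2 - w / p * e2)) / p0
      - Num.max 0 (q - d ^+ 2 * p - d ^+ 2 * (p' - w) ^+ 2 / p0)| <= 1 / 5.
Proof.
move=> p0 hp' pp' w2 d0 de he dw he1 he2 hf1 hf2 hq.
have p'0 : 0 < p' by lra.
have pp : 0 < p by lra.
have eta0 : 0 < eta by lra.
have p1000 : 10 ^+ 8 <= p by lra.
have x1 : `|w / p| <= 1.
  rewrite normrM normfV (ger0_norm (ltW pp)) ler_pdivrMr // mul1r.
  rewrite ler_norml; apply/andP; split; nra.
have xw : 0 <= w ^+ 2 / p <= 400.
  by apply/andP; split; [rewrite divr_ge0 ?sqr_ge0 // ltW | rewrite ler_pdivrMr].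
case/andP: xw => xw0 xw4.
have p400 : 400 <= p' / 2 by lra.
have p0p : p' / 2 <= p0 by rewrite /p0; clear - xw4 p400; lra.
have p0D : p0 = p' - w ^+ 2 / p by [].
clearbody p0.
have p00 : 0 < p0 by clear - p0p p400; lra.
pose u := p0^-1; have u0 : 0 < u by rewrite invr_gt0.
have uE : p0 * u = 1 by rewrite mulfV // gt_eqF.
have pu : p' * u <= 2.
  have : p' * u <= (2 * p0) * u by rewrite ler_wpM2r ?(ltW u0) //; clear - p0p; lra.
  by move: uE; clear; lra.
have us : u * (5 * 10 ^+ 7) <= 1.
  by rewrite -[leRHS]uE [p0 * u]mulrC ler_wpM2l ?(ltW u0) //; clear - p0p hp'; lra.
have dw0 : 0 <= d * `|w| by rewrite mulr_ge0 // ltW.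
have wu : d * `|w| * u <= 245 * u by rewrite ler_wpM2r // ltW.
set E1 := f1 - _; set E2 := f2 - _.
have hE1 : `|E1| <= 368.
  apply: le_trans (ler_normB _ _) _; have := normM_le x1 he1.
  by move: hf1; clear; lra.
have hE2 : `|E2| <= 368.
  apply: le_trans (ler_normB _ _) _; have := normM_le x1 he2.
  by move: hf2; clear; lra.
have A : (- (d * p) + e1) * (- (d * p) + e2) / p =
  d ^+ 2 * p - d * (e1 + e2) + e1 * e2 / p by field; rewrite gt_eqF.
have A1 : `|e1 * e2 / p| <= 1 / 10 ^+ 3.
  rewrite normrM normfV (ger0_norm (ltW pp)) ler_pdivrMr //.
  by apply: le_trans (normM_le he1 he2) _; clear - p1000; lra.
have A2 : `|d * (e1 + e2)| <= 1 / 10 ^+ 3.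
  apply: (@le_trans _ _ (eta * (184 + 184))); last by clear - he eta0; lra.
  apply: normM_le; first by rewrite ger0_norm // ltW.
  by apply: le_trans (ler_normD _ _) _; rewrite lerD.
rewrite -/u.
have -> : (- (d * (p' - w)) + E1) * (- (d * (p' - w)) + E2) * u =
   d ^+ 2 * (p' - w) ^+ 2 * u - (d * (p' - w) * u) * (E1 + E2) + E1 * E2 * u.
  by ring.
have B1 : `|d * (p' - w) * u * (E1 + E2)| <= 1 / 100.
  apply: (@le_trans _ _ ((2 * eta + 245 * u) * (368 + 368))).
    apply: normM_le; last by apply: le_trans (ler_normD _ _) _; rewrite lerD.
    rewrite normrM (ger0_norm (ltW u0)) normrM (ger0_norm (ltW d0)).
    apply: (@le_trans _ _ (d * (p' + `|w|) * u)).
      rewrite ler_wpM2r ?(ltW u0) // ler_wpM2l ?(ltW d0) //.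
      by apply: le_trans (ler_normB _ _) _; rewrite (ger0_norm (ltW p'0)).
    have : d * (p' * u) <= eta * 2 by apply: ler_pM => //; rewrite ?mulr_ge0 // ltW.
    by clear - wu; lra.
  by clear - he us u0 eta0; lra.
have B2 : `|E1 * E2 * u| <= 1 / 100.
  apply: (@le_trans _ _ (368 * 368 * u)); last by clear - us; lra.
  apply: normM_le; last by rewrite ger0_norm // ltW.
  exact: normM_le.
have K : d ^+ 2 * (p' - w) ^+ 2 * u - d ^+ 2 * p' <= 1 / 100.
  have -> : d ^+ 2 * (p' - w) ^+ 2 * u - d ^+ 2 * p' =
     d * (- (d * w)) * (2 * (p' * u)) + (d * w) ^+ 2 * u + d ^+ 2 * (w ^+ 2 / p) * (p' * u).
    rewrite /u p0D; field; rewrite !gt_eqF //.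
    have -> : p' * p - w ^+ 2 = p0 * p by rewrite p0D; field; rewrite gt_eqF.
    by rewrite mulr_gt0.
  have h1 : `|d * w| <= 245 by rewrite normrM (ger0_norm (ltW d0)).
  have pu0 : 0 <= p' * u by rewrite mulr_ge0 // ltW.
  have t1 : d * (- (d * w)) * (2 * (p' * u)) <= eta * 245 * (2 * 2).
    apply: le_trans (ler_norm _) _; apply: normM_le; last first.
      by rewrite ger0_norm; [clear - pu; lra | rewrite mulr_ge0].
    by apply: normM_le; [rewrite ger0_norm // ltW | rewrite normrN].
  have t2 : (d * w) ^+ 2 * u <= 245 * 245 * u.
    apply: le_trans (ler_norm _) _; apply: normM_le; last first.
      by rewrite ger0_norm // ltW.
    by rewrite expr2; apply: normM_le.
  have t3 : d ^+ 2 * (w ^+ 2 / p) * (p' * u) <= eta * eta * 400 * 2.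
    apply: le_trans (ler_norm _) _; apply: normM_le; last by rewrite ger0_norm.
    apply: normM_le; last by rewrite ger0_norm.
    by rewrite expr2; apply: normM_le; rewrite ger0_norm // ltW.
  have : eta * eta <= eta.
    rewrite -[leRHS]mulr1 ler_wpM2l ?(ltW eta0) //; clear - he; lra.
  by move: t1 t2 t3; clear - he us u0 eta0; lra.
move: A1 A2 B1 B2 K; rewrite A !ler_norml.
set x1' := _ / p; set x2' := d * _; set x3' := _ * (E1 + E2); set x4' := _ * u.
set x5' := _ * u; set x6' := d ^+ 2 * p.
move=> /andP[h1 h2] /andP[h3 h4] /andP[h5 h6] /andP[h7 h8] K.
have {}hq : x6' + d ^+ 2 * p' - eta <= q by move: hq; rewrite mulrDr.
have etas : eta <= 1 / 10 ^+ 3 by clear - he; lra.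
by case: (leP 0 (q - x6' - x5')) => h; apply/andP;
  clearbody x1' x2' x3' x4' x5' x6';
  clear - h K hq etas eta0 h1 h2 h3 h4 h5 h6 h7 h8; split; lra.
Qed.

Lemma add_errors (g s q a c m : R) : `|g - (s + q)| <= 1 / 20 ->
  `|q - a - c - m| <= 1 / 5 -> `|g - (a + c) - (s + m)| <= 1 / 4.
Proof.
rewrite !ler_norml => /andP[h1 h2] /andP[h3 h4].
by apply/andP; split; lra.
Qed.

Lemma square_bound (a s s' p p' : R) : 0 <= a -> a <= s + s' + 2 ->
  s ^+ 2 <= 60 * p -> s' ^+ 2 <= 60 * p' -> p' <= p -> 1 <= p ->
  a ^+ 2 <= 400 * p.
Proof.
move=> a0 as' hs hs' pp p1.
have h2 : a ^+ 2 <= (s + s' + 2) ^+ 2.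
  have h0 : 0 <= s + s' + 2 by clear - a0 as'; lra.
  by rewrite lerXn2r.
have h3 := sqr_ge0 (s - s'); have h4 := sqr_ge0 (s - 2).
have h5 := sqr_ge0 (s' - 2); clear - h2 h3 h4 h5 hs hs' pp p1; lra.
Qed.

End Scalar.

(** * Systems of vectors and their long members *)

Section VectorSystems.
Variable R : realType.
Variables (I : eqType) (edge sib : rel I).

(** The Gram relations of the vectors attached to a low rank Schur complement.  The
    b k measure how far they are from an orthogonal representation, in which edges
    have product 0 and siblings have product 1; [vs_slack] and [vs_energy] are the two
    relations that come from summing over the rows and over the whole matrix; in the
    application, W is d times the sum of all vectors. *)
Record vector_system (eta d beta : R) (W : 'rV[R]_3) (v : I -> 'rV[R]_3)
    (b : I -> R) : Prop := VectorSystem {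
  vs_edge : forall k l, edge k l -> `|dot (v k) (v l) + b k + b l| <= eta;
  vs_sib : forall k l, sib k l -> `|dot (v k) (v l) + b k + b l - 1| <= eta;
  vs_acute : forall k l, k != l -> dot (v k) (v l) <= 3;
  vs_ge0 : forall k, 0 <= b k;
  vs_slack : forall k,
    `|b k - (d * dot (v k) (v k) - dot (v k) W - beta)| <= eta;
  vs_beta : forall k, 0 <= beta <= 3 * b k;
  vs_balance : forall k l, d * b k <= 2 * b l;
  vs_energy : forall k l, k != l ->
    d ^+ 2 * (dot (v k) (v k) + dot (v l) (v l)) - eta <= dot W W + 2 * beta;
  vs_scale : 0 < d <= eta }.

Variables (eta d beta : R) (W : 'rV[R]_3) (v : I -> 'rV[R]_3) (b : I -> R).
Hypothesis vs : vector_system eta d beta W v b.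
Hypothesis eta_small : eta * (10 ^+ 9) <= 1 / 100.

Let sq k := dot (v k) (v k).
Let X k := v k - W.
Let q := dot W W + 2 * beta.
Let d0 : 0 < d. Proof. by case/andP: (vs_scale vs). Qed.
Let dle : d <= eta. Proof. by case/andP: (vs_scale vs). Qed.

(** Substituting the formula for b turns the sum of v_k . v_l, b_k and b_l into a
    product of shifted vectors plus the constant q. *)
Lemma linked_gram k l s :
  `|dot (v k) (v l) + b k + b l - s| <= eta ->
  `|dot (X k) (X l) - (s + q)| <= 3 * eta + d * (sq k + sq l).
Proof.
have := vs_slack vs k; have := vs_slack vs l; rewrite /X /q -/(sq k) -/(sq l).
rewrite !(dotBl, dotBr) (dotC W) !ler_norml => /andP[? ?] /andP[? ?] /andP[? ?].
have ? : 0 <= d * (sq k + sq l) by rewrite mulr_ge0 ?(ltW d0) // addr_ge0 ?dot_ge0.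
by apply/andP; split; lra.
Qed.

(** The product v_k . W in b_k cancels the one in v_k . X_l, so that - d |v_k|^2 is
    the only term that grows with v_k. *)
Lemma linked_long k l s :
  `|dot (v k) (v l) + b k + b l - s| <= eta ->
  `|dot (v k) (X l) + d * sq k - (s - b l + beta)| <= 2 * eta.
Proof.
have := vs_slack vs k; rewrite /X -/(sq k).
rewrite !(dotBl, dotBr) !ler_norml => /andP[? ?] /andP[? ?].
by apply/andP; split; lra.
Qed.

(** As b is nonnegative, a bound on the product of two adjacent vectors bounds the b
    of both, and with them beta. *)
Lemma edge_slack x y : edge x y -> sq x <= 60 -> sq y <= 60 ->
  [/\ b x <= 61, b y <= 61 & beta <= 183].
Proof.
have es := eta_small; have dp := d0; have dl := dle.
move=> xy hx hy; have := vs_edge vs xy; have := vs_ge0 vs x; have := vs_ge0 vs y.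
have /andP[_] := vs_beta vs x; have := cauchy (v x) (v y); rewrite -/(sq x) -/(sq y).
have := dot_ge0 (v x); have := dot_ge0 (v y); rewrite -/(sq x) -/(sq y).
rewrite ler_norml; move: (dot (v x) (v y)) => g h1 h2 c h3 h4 h5 /andP[h6 h7].
have c2 : g ^+ 2 <= 60 ^+ 2 by nra.
have : - 60 <= g by nra.
by move=> gg; split; lra.
Qed.

(* D stands for the set of indices of one gadget. *)
Variables (D : pred I) (part : I -> 'I_3).
Hypothesis tripartite : forall x y, D x -> D y -> part x != part y -> edge x y.

Section ShortFrame.
Variables (k y y' z z' : I).
Hypotheses (Dk : D k) (Dy : D y) (Dy' : D y') (Dz : D z) (Dz' : D z').
Hypotheses (yy' : sib y y') (zz' : sib z z').
Hypotheses (py' : part y' = part y) (pz' : part z' = part z).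
Hypotheses (ky : part k != part y) (kz : part k != part z) (yz : part y != part z).
Hypotheses (sy : sq y <= 60) (sy' : sq y' <= 60) (sz : sq z <= 60) (sz' : sq z' <= 60).

Let Eyz : edge y z. Proof. exact: tripartite. Qed.
Let Ey'z' : edge y' z'. Proof. by apply: tripartite; rewrite ?py' ?pz'. Qed.

Let frame l := l \in [:: y; y'; z; z'].

Let frame_short l : frame l ->
  [/\ D l, part k != part l, sq l <= 60, b l <= 61 & beta <= 183].
Proof.
have es := eta_small; have dp := d0; have dl := dle.
have [? ? ?] := edge_slack Eyz sy sz; have [? ? ?] := edge_slack Ey'z' sy' sz'.
by rewrite /frame !inE => /or4P[] /eqP->; rewrite ?py' ?pz'.
Qed.

Let frame_eps k' l : D k' -> part k' = part k -> frame l ->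
  `|dot (v k') (X l) + d * sq k'| <= 184.
Proof.
have es := eta_small; have dp := d0; have dl := dle.
move=> Dk' pk' /frame_short[Dl kl _ bl ?].
have E : edge k' l by apply: tripartite; rewrite ?pk'.
have := vs_edge vs E; rewrite -[_ + b l]subr0 => /linked_long; rewrite sub0r.
have := vs_ge0 vs l; have /andP[? _] := vs_beta vs l.
rewrite !ler_norml => ? /andP[? ?]; apply/andP; split; lra.
Qed.

Let frame_gram l l' s : frame l -> frame l' ->
  `|dot (v l) (v l') + b l + b l' - s| <= eta ->
  `|dot (X l) (X l') - (s + q)| <= 1 / 20.
Proof.
have es := eta_small; have dp := d0; have dl := dle.
move=> /frame_short[_ _ sl _ _] /frame_short[_ _ sl' _ _] /linked_gram h.
apply: le_trans h _; have : d * (sq l + sq l') <= eta * 120.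
  by rewrite ler_pM // ?(ltW d0) ?addr_ge0 ?dot_ge0 //; lra.
lra.
Qed.

Let edge0 l l' : edge l l' -> `|dot (v l) (v l') + b l + b l' - 0| <= eta.
Proof. by rewrite subr0; exact: (vs_edge vs). Qed.

Let Eyz' : edge y z'. Proof. by apply: tripartite; rewrite ?pz'. Qed.
Let Ezy' : edge z y'. Proof. by apply: tripartite; rewrite ?py' // eq_sym. Qed.

(** If two siblings are both long, then the frame, projected along both of them,
    gives two independent vectors on a line. *)
Lemma two_long k' : D k' -> part k' = part k -> sib k k' -> k != k' ->
  10 ^+ 8 <= sq k' -> sq k' <= sq k -> False.
Proof.
have es := eta_small; have dp := d0; have dl := dle.
move=> Dk' pk' Skk' nkk' long le_k.
pose w := dot (v k) (v k'); pose p := sq k; pose p' := sq k'.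
pose f (a : 'I_2) := if a == ord0 then v k else v k' - (w / p) *: v k.
have pp : 0 < p by rewrite /p; lra.
have fr : [/\ frame y, frame y', frame z & frame z'].
  by rewrite /frame !inE !eqxx ?orbT.
have [fy fy' fz fz'] := fr.
have [_ _ _ by61 _] := frame_short fy.
have bk (x : I) : D x -> part x = part k ->
    b x <= `|dot (v x) (v y)| + eta /\ dot (v x) (v y) ^+ 2 <= 60 * sq x.
  move=> Dx px; have E : edge x y by apply: tripartite; rewrite ?px.
  have := vs_edge vs E; have := vs_ge0 vs y.
  rewrite ler_norml => h1 /andP[h2 h3]; have := ler_norm (- dot (v x) (v y)).
  rewrite normrN => h4; split; first by lra.
  by apply: le_trans (cauchy _ _) _; rewrite mulrC ler_wpM2r ?dot_ge0 //; exact: sy.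
have [bk1 bk2] := bk k Dk erefl; have [bk'1 bk'2] := bk k' Dk' pk'.
(* The balance of b against the short y gives d |w| = O(1), and the product of
   v_k with y gives w^2 = O(p); both are needed, as p' may be much less than p. *)
have wb : `|w| <= b k + b k' + 1 + eta.
  have := vs_sib vs Skk'; rewrite -/w; have := vs_ge0 vs k; have := vs_ge0 vs k'.
  by rewrite !ler_norml => ? ? /andP[? ?]; apply/andP; split; lra.
have w2 : w ^+ 2 <= 400 * p.
  rewrite -real_normK ?num_real //.
  apply: (@square_bound _ _ `|dot (v k) (v y)| `|dot (v k') (v y)| p p').
  - exact: normr_ge0.
  - lra.
  - by rewrite real_normK ?num_real.
  - by rewrite real_normK ?num_real.
  - exact: le_k.
  - rewrite /p; lra.
have dw : d * `|w| <= 245.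
  have h1 := vs_balance vs k y; have h2 := vs_balance vs k' y.
  have : d * `|w| <= d * (b k + b k' + 1 + eta) by rewrite ler_wpM2l ?(ltW d0).
  have : d * (1 + eta) <= eta * 2 by rewrite ler_pM // ?(ltW d0) //; lra.
  lra.
pose p0 := p' - w ^+ 2 / p.
have p0E : dot (f ord_max) (f ord_max) = p0.
  rewrite /f /= !(dotBl, dotBr, dotZl, dotZr) (dotC (v k')) -/w -/(sq k) -/(sq k').
  by rewrite -/p -/p' /p0; field; rewrite gt_eqF.
have p0pos : 0 < p0.
  have : w ^+ 2 / p <= 400 by rewrite ler_pdivrMr.
  by rewrite /p0 /p'; lra.
have two (a : 'I_2) : a = ord0 \/ a = ord_max.
  by case: a => [[|[|//]] ?]; [left | right]; apply: val_inj.
apply: (@projected_gram R 2 2 f (fun i => X (if i == ord0 then y else z))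
   (fun i => X (if i == ord0 then y' else z'))
   (Num.max 0 (q - d ^+ 2 * p - d ^+ 2 * (p' - w) ^+ 2 / p0)) (1 / 4)) => //.
- by move=> a; case: (two a) => ->; rewrite ?p0E.
- have o : dot (v k) (v k' - (w / p) *: v k) = 0.
    by rewrite dotBr dotZr -/w -/(sq k) -/p divfK ?subrr // gt_eqF.
  by move=> a a'; case: (two a) => ->; case: (two a') => -> //=; rewrite /f /= ?o // dotC.
- by rewrite le_max lexx.
- lra.
have key l l' s : frame l -> frame l' ->
    `|dot (v l) (v l') + b l + b l' - s| <= eta ->
    `|dot (X l) (X l') - (\sum_a dot (f a) (X l) * dot (f a) (X l') / dot (f a) (f a))
       - (s + Num.max 0 (q - d ^+ 2 * p - d ^+ 2 * (p' - w) ^+ 2 / p0))| <= 1 / 4.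
  move=> fl fl' hs; rewrite big_ord_recl big_ord1 (_ : lift _ _ = ord_max); last first.
    exact: val_inj.
  rewrite p0E /f /= -/(sq k) -/p !(dotBl (v k')) !dotZl.
  have e1 := frame_eps Dk erefl fl; have e2 := frame_eps Dk erefl fl'.
  have f1 := frame_eps Dk' pk' fl; have f2 := frame_eps Dk' pk' fl'.
  have hq := vs_energy vs nkk'.
  have := @project_two R p p' w q d _ _ _ _ eta long le_k w2 d0 dle _ dw e1 e2 f1 f2 hq.
  rewrite -/p0 -/p -/p'.
  have -> : - (d * p) + (dot (v k) (X l) + d * p) = dot (v k) (X l) by ring.
  have -> : - (d * p) + (dot (v k) (X l') + d * p) = dot (v k) (X l') by ring.
  have -> : - (d * (p' - w)) + (dot (v k') (X l) + d * p' - w / p * (dot (v k) (X l) + d * p))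
     = dot (v k') (X l) - w / p * dot (v k) (X l) by field; rewrite gt_eqF.
  have -> : - (d * (p' - w)) + (dot (v k') (X l') + d * p' - w / p * (dot (v k) (X l') + d * p))
     = dot (v k') (X l') - w / p * dot (v k) (X l') by field; rewrite gt_eqF.
  have e6 : eta * (10 ^+ 6) <= 1 by lra.
  by move=> /(_ e6) h; exact: add_errors (frame_gram fl fl' hs) h.
move=> i j; case: (two i) => ->; case: (two j) => ->; rewrite /=.
- by apply: key => //; rewrite mulr1n; exact: (vs_sib vs).
- by apply: key => //; exact: edge0.
- by apply: key => //; exact: edge0.
- by apply: key => //; rewrite mulr1n; exact: (vs_sib vs).
Qed.

(** If exactly one vector k of a vertex is long, then its two siblings and the
    frame, projected along k, give three independent vectors in a plane. *)
Lemma one_long k' k'' : D k' -> D k'' -> part k' = part k -> part k'' = part k ->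
  sib k k' -> sib k k'' -> sib k' k'' -> k != k' ->
  sq k' <= 10 ^+ 8 -> sq k'' <= 10 ^+ 8 ->
  10 ^+ 12 <= sq k -> False.
Proof.
have es := eta_small; have dp := d0; have dl := dle.
move=> Dk' Dk'' pk' pk'' Skk' Skk'' Sk'k'' nkk' sk' sk'' long.
pose p := sq k; have pp : 0 < p by rewrite /p; lra.
have fr : [/\ frame y, frame y', frame z & frame z'].
  by rewrite /frame !inE !eqxx ?orbT.
have [fy fy' fz fz'] := fr.
have [_ _ _ by61 beta183] := frame_short fy.
(* The indices whose vectors are to be projected along v_k. *)
pose good l := frame l || (l == k') || (l == k'').
have good_sq l : good l -> sq l <= 10 ^+ 8.
  case/orP=> [/orP[/frame_short[_ _ ? _ _]|/eqP->]|/eqP->] //; lra.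
have good_b l : good l -> b l <= 9 * 10 ^+ 4.
  have h x : D x -> part x = part k -> sq x <= 10 ^+ 8 -> b x <= 9 * 10 ^+ 4.
    move=> Dx px sx; have E : edge x y by apply: tripartite; rewrite ?px.
    have := vs_edge vs E; have := vs_ge0 vs y.
    have : dot (v x) (v y) ^+ 2 <= (10 ^+ 8) * 60.
      by apply: le_trans (cauchy _ _) _; rewrite ler_pM ?dot_ge0 //; exact: sy.
    move: (dot (v x) (v y)) => g g2 by0; rewrite ler_norml => /andP[h1 h2].
    have g0 : - (8 * 10 ^+ 4) <= g.
      by rewrite leNgt; apply/negP => g3; nra.
    by lra.
  case/orP=> [/orP[/frame_short[_ _ _ ? _]|/eqP->]|/eqP->]; last 2 first.
  - exact: h.
  - exact: h.
  lra.
have good_eps l : good l -> `|dot (v k) (X l) + d * p| <= 10 ^+ 5.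
  move=> gl; have : exists s, 0 <= s <= 1 /\ `|dot (v k) (v l) + b k + b l - s| <= eta.
    case/orP: gl => [/orP[fl|/eqP->]|/eqP->].
    - have [Dl kl _ _ _] := frame_short fl.
      by exists 0; split; [rewrite lexx ler01 | apply: edge0; apply: tripartite].
    - by exists 1; split; [rewrite lexx ler01 | apply: (vs_sib vs)].
    - by exists 1; split; [rewrite lexx ler01 | apply: (vs_sib vs)].
  case=> s [/andP[? ?] /linked_long].
  have := vs_ge0 vs l; have /andP[? _] := vs_beta vs l; have := good_b l gl.
  by rewrite /p !ler_norml => ? ? /andP[? ?]; apply/andP; split; lra.
pose x (i : 'I_3) := if i == 0 :> nat then k' else if i == 1%N :> nat then y else z.
pose x' (i : 'I_3) := if i == 0 :> nat then k'' else if i == 1%N :> nat then y' else z'.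
apply: (@projected_gram R 1 3 (fun=> v k) (fun i => X (x i)) (fun i => X (x' i))
   (Num.max 0 (q - d ^+ 2 * p)) (1 / 4)) => //.
- by move=> a a'; rewrite !ord1 eqxx.
- by rewrite le_max lexx.
- lra.
have key l l' s : good l -> good l' ->
    `|dot (v l) (v l') + b l + b l' - s| <= eta ->
    `|dot (X l) (X l') - (\sum_(a < 1) dot (v k) (X l) * dot (v k) (X l') / dot (v k) (v k))
       - (s + Num.max 0 (q - d ^+ 2 * p))| <= 1 / 4.
  move=> gl gl' hs; rewrite big_ord1 -/(sq k) -/p.
  have e1 := good_eps l gl; have e2 := good_eps l' gl'.
  have hq : d ^+ 2 * p - eta <= q.
    have := vs_energy vs nkk'; rewrite -/(sq k) -/(sq k') -/p -/q.
    have : 0 <= d ^+ 2 * sq k' by rewrite mulr_ge0 ?sqr_ge0 ?dot_ge0.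
    lra.
  have := @project_one R p q d _ _ eta long d0 dle eta_small e1 e2 hq.
  have -> : - (d * p) + (dot (v k) (X l) + d * p) = dot (v k) (X l) by ring.
  have -> : - (d * p) + (dot (v k) (X l') + d * p) = dot (v k) (X l') by ring.
  move=> h; rewrite -[X in `|_ - X - _|]addr0; apply: (@add_errors _ _ _ q); last first.
    by rewrite subr0.
  apply: le_trans (linked_gram hs) _.
  have : d * (sq l + sq l') <= eta * (2 * 10 ^+ 8).
    rewrite ler_pM // ?(ltW d0) ?addr_ge0 ?dot_ge0 //.
    by have := good_sq l gl; have := good_sq l' gl'; lra.
  lra.
have gf l : frame l -> good l by rewrite /good => ->.
have gk' : good k' by rewrite /good eqxx ?orbT.
have gk'' : good k'' by rewrite /good eqxx ?orbT.
have E a l : D a -> part a = part k -> frame l -> edge a l /\ edge l a.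
  by move=> Da pa /frame_short[Dl kl _ _ _]; split; apply: tripartite; rewrite ?pa // eq_sym.
move=> [[|[|[|//]]] hi] [[|[|[|//]]] hj]; rewrite /x /x' /=; apply: key => //;
  try exact: gf; try (by rewrite mulr1n; apply: (vs_sib vs)); apply: edge0 => //.
- exact: (proj1 (E _ _ Dk' pk' fy')).
- exact: (proj1 (E _ _ Dk' pk' fz')).
- exact: (proj2 (E _ _ Dk'' pk'' fy)).
- exact: (proj2 (E _ _ Dk'' pk'' fz)).
Qed.

End ShortFrame.
End VectorSystems.

(** * Colourings and the gadget of Peeters *)

Section Colorings.

(** If the two ends have the same colour, then the path a, b, c, d alternates
    between the other two colours; otherwise a and d take the third colour, and b
    and c the colours of the opposite ends. *)
Definition gadget_color (alpha beta : 'I_3) (q : 'I_4) : 'I_3 :=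
  if alpha == beta then (if odd q then alpha - 1 else alpha + 1)
  else if q == 1%N :> nat then beta
  else if q == 2%N :> nat then alpha
  else - (alpha + beta).

Lemma gadget_colorP alpha beta :
  [&& [forall q : 'I_4, (val q \in [:: 0; 1; 3]) ==> (gadget_color alpha beta q != alpha)],
      [forall q : 'I_4, (val q \in [:: 0; 2; 3]) ==> (gadget_color alpha beta q != beta)]
    & [forall q : 'I_4, forall q' : 'I_4,
       ((val q, val q') \in [:: (0, 1); (1, 2); (2, 3)]) ==>
         (gadget_color alpha beta q != gadget_color alpha beta q')]]%N.
Proof.
apply/and3P; split; [apply/forallP=> q | apply/forallP => q|
  apply/'forall_forallP => q q'];
  move: alpha beta q => [[|[|[|//]]] ?] [[|[|[|//]]] ?] [[|[|[|[|//]]]] ?] //;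
  by move: q' => [[|[|[|[|//]]]] ?].
Qed.

Lemma peeters_colorable (G : sgraph) (o : rel G) :
  colorable 3 G -> colorable 3 (peeters o).
Proof.
case=> f fP.
pose g (x : peeters o) := match x with
  | inl v => f v
  | inr (p, q) => gadget_color (f (val p).1) (f (val p).2) q
  end.
have arc x y : peeters_arc x y -> g x != g y.
  case: x y => [v|[p q]] [w|[p' q']] //=; first exact: fP.
    have /and3P[/forallP/(_ q')/implyP h1 /forallP/(_ q')/implyP h2 _] :=
       gadget_colorP (f (val p').1) (f (val p').2).
    by case/orP=> /andP[/eqP-> hq]; rewrite eq_sym; [exact: h1 | exact: h2].
  case/andP=> /eqP<- hq.
  have /and3P[_ _ /'forall_forallP /(_ q q') /implyP] :=
     gadget_colorP (f (val p).1) (f (val p).2).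
  exact.
exists g => x y /orP[/arc //|/arc]; by rewrite eq_sym.
Qed.

Lemma robust_colorable (G : sgraph) c (exposed : G -> 'I_3) :
  colorable 3 G -> colorable 3 (robust c exposed).
Proof.
case=> f fP; exists (fun x : robust c exposed => f x.1.1 + x.1.2 - exposed x.1.1).
move=> [[v a] t] [[w b] s] /= /orP[/andP[/eqP<- ab]|/and3P[vw /eqP-> /eqP->]].
  by rewrite (inj_eq (addIr _)) (inj_eq (addrI _)).
by rewrite !addrK fP.
Qed.

Variable R : realType.
Implicit Types u v w : 'rV[R]_3.

(** Nearly orthonormal vectors are nearly dual to themselves. *)
Lemma near_onb (x0 x1 x2 u w : 'rV[R]_3) e : e <= 1 / 100 ->
  `|dot x0 x0 - 1| <= e -> `|dot x1 x1 - 1| <= e -> `|dot x2 x2 - 1| <= e ->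
  `|dot x0 x1| <= e -> `|dot x0 x2| <= e -> `|dot x1 x2| <= e ->
  dot u u <= 1 + e -> dot w w <= 1 + e ->
  `|dot u w - (dot u x0 * dot x0 w + dot u x1 * dot x1 w + dot u x2 * dot x2 w)|
    <= 66 * e.
Proof.
move=> e1 h00 h11 h22 h01 h02 h12 hu hw.
pose x (i : 'I_3) := tnth [tuple x0; x1; x2] i.
have hx i j : `|dot (x i) (x j) - (i == j)%:R| <= e.
  case: i j => [[|[|[|//]]] ?] [[|[|[|//]]] ?]; rewrite /x !(tnth_nth 0) /=;
  rewrite ?(mulr0n, mulr1n, subr0) // dotC //.
have e0 : 0 <= e := le_trans (normr_ge0 _) h00.
have := near_parseval u w _ hx; rewrite !big_ord_recl !big_ord0 /x !(tnth_nth 0) /=.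
rewrite !addr0 !addrA => h; apply: le_trans (h _) _; first by lra.
have bd (y z : 'rV[R]_3) : `|dot y y - 1| <= e -> dot z z <= 1 + e -> `|dot y z| <= 11 / 10.
  move=> hy hz; have := cauchy y z; move: hy; rewrite ler_norml => /andP[y1 y2].
  have := dot_ge0 y; have := dot_ge0 z; move: (dot y z) => a z0 y0 h'.
  rewrite ler_norml; have : a ^+ 2 <= (1 + e) ^+ 2 by nra.
  move=> h2; apply/andP; split; nra.
have := bd x0 u h00 hu; have := bd x1 u h11 hu; have := bd x2 u h22 hu.
have := bd x0 w h00 hw; have := bd x1 w h11 hw; have := bd x2 w h22 hw.
rewrite ![dot u _]dotC => a1 a2 a3 a4 a5 a6.
have s1 : `|dot x0 u| + `|dot x1 u| + `|dot x2 u| <= 33 / 10 by lra.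
have s2 : `|dot x0 w| + `|dot x1 w| + `|dot x2 w| <= 33 / 10 by lra.
rewrite -mulrA; apply: (@le_trans _ _ (6 * e * (33 / 10 * (33 / 10)))); last by lra.
by rewrite ler_wpM2l ?mulr_ge0 // ler_pM // !addr_ge0.
Qed.

(** The algebraic core of the rigidity of the gadget: expand the product
    j1^2 j3^2 (c1^2 + c2^2) (d2^2 + d3^2), where the last two factors are nearly 1
    and every monomial contains a product that nearly vanishes. *)
Lemma coordinate_frame (j1 j3 c1 c2 d2 d3 e : R) : e <= 1 / 10 ^+ 3 ->
  - e <= (j1 ^+ 2 + j3 ^+ 2) - 1 <= e -> - e <= (c1 ^+ 2 + c2 ^+ 2) - 1 <= e ->
  - e <= (d2 ^+ 2 + d3 ^+ 2) - 1 <= e -> - e <= j3 * d3 <= e ->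
  - e <= j1 * c1 <= e -> - e <= c2 * d2 <= e ->
  `|j1| <= 11 / 10 -> `|j3| <= 11 / 10 -> `|c1| <= 11 / 10 ->
  `|c2| <= 11 / 10 -> `|d2| <= 11 / 10 -> `|d3| <= 11 / 10 ->
  j1 ^+ 2 <= 1 / 100 \/ 99 / 100 <= j1 ^+ 2.
Proof.
move=> he J C D; have e2 x : - e <= x <= e -> x ^+ 2 <= 1 / 10 ^+ 6.
  by case/andP=> h1 h2; clear - he h1 h2; nra.
have s2 (x : R) : `|x| <= 11 / 10 -> x ^+ 2 <= 3 / 2.
  by rewrite ler_norml => /andP[h1 h2]; clear - h1 h2; nra.
move=> /e2 JD /e2 JC /e2 CD /s2 p1 /s2 p3 /s2 p4 /s2 p5 /s2 p8 /s2 p9.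
have m2 (x y z : R) : x ^+ 2 <= 1 / 10 ^+ 6 -> y ^+ 2 <= 3 / 2 ->
    z ^+ 2 <= 3 / 2 -> x ^+ 2 * (y ^+ 2 * z ^+ 2) <= 3 / 10 ^+ 6.
  move=> hx hy hz; apply: (@le_trans _ _ (1 / 10 ^+ 6 * (3 / 2 * (3 / 2)))).
    apply: ler_pM => //; [exact: sqr_ge0 | by rewrite mulr_ge0 ?sqr_ge0 |].
    by apply: ler_pM => //; exact: sqr_ge0.
  by clear; lra.
move: (m2 _ _ _ JC p3 p8) (m2 _ _ _ JC p3 p9) (m2 _ _ _ CD p1 p3) (m2 _ _ _ JD p1 p5).
have := mulr_ge0 (sqr_ge0 j1) (sqr_ge0 j3); have := sqr_ge0 j1.
move: J C D; rewrite !exprMn; clear - he.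
move: (j1 ^+ 2) (j3 ^+ 2) (c1 ^+ 2) (c2 ^+ 2) (d2 ^+ 2) (d3 ^+ 2) => x y c c' d d'.
move=> /andP[J1 J2] /andP[C1 C2] /andP[D1 D2] x0 xy0 t1 t2 t3 t4.
have t5 : x * y * ((c + c') * (d + d')) <= 12 / 10 ^+ 6.
  by clear - t1 t2 t3 t4; lra.
have t6 : 9 / 10 <= (c + c') * (d + d').
  have h1 : 999 / 1000 <= c + c' by clear - C1 he; lra.
  have h2 : 999 / 1000 <= d + d' by clear - D1 he; lra.
  apply: (@le_trans _ _ (999 / 1000 * (999 / 1000))); first by clear; lra.
  by apply: ler_pM => //; clear; lra.
have t7 : x * y <= 2 / 10 ^+ 5.
  have h : x * y * (9 / 10) <= x * y * ((c + c') * (d + d')) by rewrite ler_wpM2l.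
  by clear - h t5; lra.
have [hh|hh] := leP x (1 / 100); first by left.
have [h1|h1] := leP (99 / 100) x; first by right.
have h2 : 0 <= (x - 1 / 100) * (99 / 100 - x).
  by apply: mulr_ge0; [clear - hh | clear - h1]; lra.
have h3 : x * (999 / 1000 - x) <= x * y by rewrite ler_wpM2l //; clear - J1 he; lra.
by clear - h1 h2 h3 t7; lra.
Qed.

(** In the orthonormal basis (i, a, b), the three vectors j, c and d lie in the
    three coordinate planes, and are orthogonal in pairs.  Such a frame consists
    of basis vectors up to sign, so the first coordinate of j is 0, 1 or -1. *)
Lemma gadget_dichotomy (i j a b c d : 'rV[R]_3) e : e <= 1 / 10 ^+ 5 ->
  [/\ `|dot i i - 1| <= e, `|dot a a - 1| <= e & `|dot b b - 1| <= e] ->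
  [/\ `|dot j j - 1| <= e, `|dot c c - 1| <= e & `|dot d d - 1| <= e] ->
  [/\ `|dot i a| <= e, `|dot i b| <= e & `|dot a b| <= e] ->
  [/\ `|dot j c| <= e, `|dot j d| <= e & `|dot c d| <= e] ->
  [/\ `|dot a j| <= e, `|dot i d| <= e & `|dot b c| <= e] ->
  dot i j ^+ 2 <= 1 / 100 \/ 99 / 100 <= dot i j ^+ 2.
Proof.
move=> e1 [ii aa bb] [jj cc dd] [ia ib ab] [jc jd cd] [aj id bc].
have e0 : 0 <= e := le_trans (normr_ge0 _) ii.
have ub (x : 'rV[R]_3) : `|dot x x - 1| <= e -> dot x x <= 1 + e.
  by rewrite ler_norml => /andP[_]; lra.
have P x y hx hy := @near_onb i a b x y e _ ii aa bb ia ib ab (ub x hx) (ub y hy).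
have e2 : e <= 1 / 100 by lra.
move: (P e2 j j jj jj) (P e2 c c cc cc) (P e2 d d dd dd)
  (P e2 j c jj cc) (P e2 j d jj dd) (P e2 c d cc dd).
have C (x y : 'rV[R]_3) : `|dot x x - 1| <= e -> `|dot y y - 1| <= e ->
    `|dot x y| <= 11 / 10.
  rewrite !ler_norml => /andP[x1 x2] /andP[y1 y2]; have := cauchy x y.
  have := dot_ge0 x; have := dot_ge0 y; move: (dot x y) => r y0 x0 h'.
  have h2 : r ^+ 2 <= (11 / 10) ^+ 2 by nra.
  apply/andP; split; nra.
move: (C i j ii jj) (C b j bb jj) (C i c ii cc) (C a c aa cc) (C a d aa dd) (C b d bb dd).
rewrite !(dotC j i) !(dotC j a) !(dotC j b) !(dotC c i) !(dotC c a) !(dotC c b).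
rewrite !(dotC d i) !(dotC d a) !(dotC d b).
move: jj cc dd jc jd cd aj id bc {P C ub ii aa bb ia ib ab}.
move: (dot i j) (dot a j) (dot b j) (dot i c) (dot a c) (dot b c).
move: (dot i d) (dot a d) (dot b d) (dot j j) (dot c c) (dot d d).
move: (dot j c) (dot j d) (dot c d) => {i j a b c d}.
move=> jc jd cd d1 d2 d3 jj cc dd j1 j2 j3 c1 c2 c3.
have small (x y : R) : `|x| <= e -> `|y| <= 11 / 10 -> `|x * y| <= 11 / 10 * e.
  by move=> hx hy; rewrite normrM mulrC ler_pM.
have small2 (x y : R) : `|y| <= e -> `|x| <= 11 / 10 -> `|x * y| <= 11 / 10 * e.
  by move=> hx hy; rewrite mulrC small.
have sq (x : R) : `|x| <= e -> `|x * x| <= e.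
  by move=> hx; rewrite normrM; have := normr_ge0 x; nra.
move=> ujj ucc udd ujc ujd ucd hj2 hd1 hc3 b1 b3 b4 b5 b8 b9.
move=> hjj hcc hdd hjc hjd hcd.
have close (t x s r m : R) : `|t - x| <= 66 * e -> `|t - s| <= e -> x = m + r ->
    `|r| <= 3 * e -> - (70 * e) <= m - s <= 70 * e.
  rewrite !ler_norml => h1 h2 xE h3; rewrite {}xE in h1; move: h1 h2 h3; clear.
  by move=> /andP[? ?] /andP[? ?] /andP[? ?]; apply/andP; split; lra.
have two (x y : R) : `|x| <= 11 / 10 * e -> `|y| <= 11 / 10 * e -> `|x + y| <= 3 * e.
  by move=> hx hy; apply: le_trans (ler_normD _ _) _; clear - hx hy e0; lra.
have one (x : R) : `|x| <= e -> `|x * x| <= 3 * e.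
  by move=> hx; apply: le_trans (sq _ hx) _; clear - e0; lra.
have J : - (70 * e) <= (j1 ^+ 2 + j3 ^+ 2) - 1 <= 70 * e.
  by apply: (close _ _ _ _ _ hjj ujj _ (one _ hj2)); ring.
have Cc : - (70 * e) <= (c1 ^+ 2 + c2 ^+ 2) - 1 <= 70 * e.
  by apply: (close _ _ _ _ _ hcc ucc _ (one _ hc3)); ring.
have Dd : - (70 * e) <= (d2 ^+ 2 + d3 ^+ 2) - 1 <= 70 * e.
  by apply: (close _ _ _ _ _ hdd udd _ (one _ hd1)); ring.
have JD : - (70 * e) <= j3 * d3 <= 70 * e.
  have := close _ _ 0 _ (j3 * d3) hjd _ _ (two _ _ (small2 _ _ hd1 b1) (small _ _ hj2 b8)).
  by rewrite !subr0; apply=> //; ring.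
have JC : - (70 * e) <= j1 * c1 <= 70 * e.
  have := close _ _ 0 _ (j1 * c1) hjc _ _ (two _ _ (small _ _ hj2 b5) (small2 _ _ hc3 b3)).
  by rewrite !subr0; apply=> //; ring.
have CD : - (70 * e) <= c2 * d2 <= 70 * e.
  have := close _ _ 0 _ (c2 * d2) hcd _ _ (two _ _ (small2 _ _ hd1 b4) (small _ _ hc3 b9)).
  by rewrite !subr0; apply=> //; ring.
by move: J Cc Dd JD JC CD b1 b3 b4 b5 b8 b9; apply: coordinate_frame; clear - e1; lra.
Qed.

(** A maximal family of pairwise nearly orthogonal vectors has at most three
    members, and every other vector is nearly parallel to one of them. *)
Lemma color_by_direction (T : finType) (u : T -> 'rV[R]_3) :
  (forall x, `|dot (u x) (u x) - 1| <= 1 / 10 ^+ 3) ->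
  (forall x y, x != y ->
     dot (u x) (u y) ^+ 2 <= 1 / 100 \/ 99 / 100 <= dot (u x) (u y) ^+ 2) ->
  exists f : T -> 'I_3, forall x y,
    `|dot (u x) (u y)| <= 1 / 100 -> f x != f y.
Proof.
move=> un dic.
pose P (S : {set T}) := [forall x in S, forall y in S,
   (x != y) ==> (dot (u x) (u y) ^+ 2 <= 1 / 100)].
have P0 : P set0 by apply/forall_inP => x; rewrite inE.
have [S /maxsetP[PS Smax] _] := maxset_exists P0.
have un' x : 999 / 1000 <= dot (u x) (u x) <= 1001 / 10 ^+ 3.
  by have := un x; rewrite ler_norml => /andP[? ?]; apply/andP; split; lra.
have S3 : (#|S| <= 3)%N.
  have := trace_bound (mem S) u.
  have lo : (999 / 1000) * #|S|%:R <= \sum_(x in S) dot (u x) (u x).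
    rewrite mulr_natr -sumr_const; apply: ler_sum => x _.
    by case/andP: (un' x).
  have hi : \sum_(x in S) \sum_(y in S) dot (u x) (u y) ^+ 2 <=
      (1 / 100 * #|S|%:R + 102 / 100) * #|S|%:R.
    rewrite [leRHS]mulr_natr -sumr_const; apply: ler_sum => x xS.
    rewrite (bigD1 x) //= addrC; apply: lerD.
      apply: (@le_trans _ _ (\sum_(y in S) 1 / 100)); last first.
        by rewrite sumr_const -[leLHS]mulr_natl mulrC.
      rewrite [leRHS](bigD1 x) //= -[leLHS]add0r; apply: lerD; first by lra.
      apply: ler_sum => y /andP[yS yx]; rewrite dotC.
      by have /forall_inP/(_ _ yS)/forall_inP/(_ _ xS)/implyP/(_ yx) := PS; rewrite dotC.
    by case/andP: (un' x) => ? ?; nra.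
  move=> tr; rewrite leqNgt; apply/negP => S4.
  have : 4%:R <= #|S|%:R :> R by rewrite ler_nat.
  move: (#|S|%:R) lo hi tr => N lo hi tr N4.
  have : ((999 / 1000) * N) ^+ 2 <= 3 * ((1 / 100 * N + 102 / 100) * N) by nra.
  nra.
have near x : exists c, (c \in S) && (98 / 100 <= dot (u x) (u c) ^+ 2).
  have [xS|xS] := boolP (x \in S).
    by exists x; rewrite xS /=; case/andP: (un' x) => ? ?; nra.
  have : ~~ P (x |: S).
    apply/negP => h; have := Smax _ h (subsetUr _ _) => E.
    by move: xS; rewrite -E setU11.
  rewrite /P => /forall_inPn[y yS /forall_inPn[z zS]].
  rewrite negb_imply -ltNge => /andP[yz h].
  case/setU1P: yS => [yx|yS]; case/setU1P: zS => [zx|zS].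
  - by move: yz; rewrite yx zx eqxx.
  - exists z; rewrite zS /=; rewrite -yx; case: (dic y z yz) => ?; lra.
  - exists y; rewrite yS /=; rewrite -zx dotC; case: (dic y z yz) => ?; lra.
  - have /forall_inP/(_ _ yS)/forall_inP/(_ _ zS)/implyP/(_ yz) := PS; lra.
have [g gP] := fin_all_exists near.
have gS x : g x \in S by case/andP: (gP x).
exists (fun x => inord (index (g x) (enum S))) => x y hxy.
apply/eqP => /(congr1 val); rewrite /= !inordK.
(* Two nearly orthogonal vectors would both be nearly parallel to u (g x):
   this contradicts Bessel's inequality. *)
- move/(congr1 (nth x (enum S))); rewrite !nth_index ?mem_enum // => gE.
  case/andP: (gP x) => _ hx; case/andP: (gP y) => _; rewrite -gE => hy.
  case/andP: (un' x) => x1 x2; case/andP: (un' y) => y1 y2.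
  case/andP: (un' (g x)) => c1 c2.
  pose p := dot (u x) (u (g x)); pose q := dot (u y) (u (g x)).
  have := dot_ge0 (u (g x) - p *: u x - q *: u y).
  rewrite !(dotBl, dotBr, dotZl, dotZr) (dotC (u y) (u x)).
  rewrite (dotC (u (g x)) (u x)) (dotC (u (g x)) (u y)) -/p -/q.
  move: hx hy hxy; rewrite -/p -/q ler_norml.
  have : p ^+ 2 <= 102 / 100.
    have := cauchy (u x) (u (g x)); rewrite -/p; clear - x2 c2 x1.
    move: (dot _ _) (dot _ _) x1 x2 c2 => a c ? ? ?; nra.
  have : q ^+ 2 <= 102 / 100.
    have := cauchy (u y) (u (g x)); rewrite -/q; clear - y2 c2 y1.
    move: (dot _ _) (dot _ _) y1 y2 c2 => a c ? ? ?; nra.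
  move: p q (dot (u x) (u y)) x1 x2 y1 y2 c1 c2.
  move: (dot (u x) (u x)) (dot (u y) (u y)) (dot (u (g x)) (u (g x))).
  move=> xx yy cc p q r x1 x2 y1 y2 c1 c2 hq hp lp lq /andP[r1 r2] E.
  have pq1 : - (102 / 100) <= p * q.
    by have h := sqr_ge0 (p + q); clear - h hp hq; lra.
  have pq2 : p * q <= 102 / 100.
    by have h := sqr_ge0 (p - q); clear - h hp hq; lra.
  have pqr : p * q * r <= 102 / 10 ^+ 4.
    have h1 := mulr_ge0 (_ : 0 <= 102 / 100 - p * q) (_ : 0 <= r + 1 / 100).
    have h2 := mulr_ge0 (_ : 0 <= p * q + 102 / 100) (_ : 0 <= 1 / 100 - r).
    have {}h1 : 0 <= (102 / 100 - p * q) * (r + 1 / 100).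
      by apply: h1; [clear - pq2 | clear - r1]; lra.
    have {}h2 : 0 <= (p * q + 102 / 100) * (1 / 100 - r).
      by apply: h2; [clear - pq1 | clear - r2]; lra.
    by clear - h1 h2; lra.
  have px : p ^+ 2 * xx <= p ^+ 2 * (1001 / 10 ^+ 3) by rewrite ler_wpM2l // sqr_ge0.
  have qy : q ^+ 2 * yy <= q ^+ 2 * (1001 / 10 ^+ 3) by rewrite ler_wpM2l // sqr_ge0.
  by clear - E px qy pqr lp lq c2; lra.
- by rewrite (leq_trans _ S3) // cardE index_mem mem_enum.
- by rewrite (leq_trans _ S3) // cardE index_mem mem_enum.
Qed.

(** A nearly orthonormal representation of the Peeters supergraph in space yields
    a 3-colouring of the original graph. *)
Lemma colorable_of_representation (G : sgraph) (o : rel G) e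
    (u : peeters o -> 'rV[R]_3) :
  pair_listing o -> e <= 1 / 10 ^+ 5 ->
  (forall x, `|dot (u x) (u x) - 1| <= e) ->
  (forall x y, adj x y -> `|dot (u x) (u y)| <= e) ->
  colorable 3 G.
Proof.
move=> [oi oP] e1 un orth.
have dich (x y : G) : o x y -> dot (u (inl x)) (u (inl y)) ^+ 2 <= 1 / 100 \/
   99 / 100 <= dot (u (inl x)) (u (inl y)) ^+ 2.
  move=> oxy; pose p : {p : G * G | o p.1 p.2} := Sub (x, y) oxy.
  pose w (q : 'I_4) : peeters o := inr (p, q).
  apply: (@gadget_dichotomy (u (inl x)) (u (inl y)) (u (w (Ordinal (isT : (0 < 4)%N))))
    (u (w (Ordinal (isT : (1 < 4)%N)))) (u (w (Ordinal (isT : (2 < 4)%N))))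
    (u (w (Ordinal (isT : (3 < 4)%N)))) _ e1).
  - by split; apply: un.
  - by split; apply: un.
  - by split; apply: orth; rewrite /= /peeters_adj /= ?eqxx ?orbT.
  - by split; apply: orth; rewrite /= /peeters_adj /= ?eqxx ?orbT.
  - by split; apply: orth; rewrite /= /peeters_adj /= ?eqxx ?orbT.
have un' (x : G) : `|dot (u (inl x)) (u (inl x)) - 1| <= 1 / 10 ^+ 3.
  by apply: le_trans (un _) _; clear - e1; lra.
have [|f fP] := color_by_direction un'.
  move=> x y /oP; case oxy: (o x y); first by move=> _; exact: dich.
  by move=> /= oyx; rewrite dotC; apply: dich.
exists f => x y xy; apply: fP; apply: le_trans (orth _ _ _) _; last first.
  by clear - e1; lra.
by rewrite /= /peeters_adj /= xy.
Qed.

End Colorings.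

(** * Colourings from vectors on the robust graph *)

Section RobustGraph.
Variables (R : realType) (K : sgraph) (exposed : K -> 'I_3).
Let Gs := robust 5 exposed.
Let I : finType := 'I_(3 * #|Gs|).

Lemma parent_indexing (G : sgraph) :
  exists idx : G -> 'I_3 -> 'I_(3 * #|G|),
    (forall x a, parent (idx x a) = x) /\ (forall x, injective (idx x)).
Proof.
exists (fun x a => enum_val (cast_ord (esym (card_parent x)) a)); split.
  move=> x a; apply/eqP; have := enum_valP (cast_ord (esym (card_parent x)) a).
  by rewrite inE.
by move=> x a b /enum_val_inj /cast_ord_inj.
Qed.

Definition index_edge (k l : I) := adj (parent k) (parent l).
Definition index_sib (k l : I) := (k != l) && (parent k == parent l).

Definition gadget_of (k : I) : K := (parent k).1.1.
Definition part_of (k : I) : 'I_3 := (parent k).1.2.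

Lemma gadget_edge k l : gadget_of k = gadget_of l -> part_of k != part_of l ->
  index_edge k l.
Proof.
rewrite /gadget_of /part_of /index_edge.
case: (parent k) (parent l) => [[g a] t] [[g' a'] t'] /= -> ne.
by rewrite eqxx ne.
Qed.

Lemma sib_gadget k l : index_sib k l ->
  gadget_of l = gadget_of k /\ part_of l = part_of k.
Proof. by case/andP=> _ /eqP; rewrite /gadget_of /part_of => ->. Qed.

Lemma sib_sym k l : index_sib k l = index_sib l k.
Proof. by rewrite /index_sib eq_sym [parent k == _]eq_sym. Qed.

Lemma other_parts (a : 'I_3) :
  exists b c : 'I_3, [/\ a != b, a != c & b != c].
Proof.
by exists (a + 1), (a + 2); case: a => [[|[|[|//]]] ?].
Qed.

Lemma siblings (k : I) : exists k' k'' : I,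
  [/\ index_sib k k', index_sib k k'' & index_sib k' k''].
Proof.
have := card_parent (parent k); rewrite (cardsD1 k) inE eqxx add1n => /succn_inj c2.
have /card_gt0P[k' k'P] : (0 < #|[set l | parent l == parent k] :\ k|)%N by rewrite c2.
move: c2; rewrite (cardsD1 k') k'P add1n => /succn_inj c1.
have /card_gt0P[k'' k''P] :
  (0 < #|([set l | parent l == parent k] :\ k) :\ k'|)%N by rewrite c1.
move: k'P k''P; rewrite !inE => /andP[n1 /eqP p1] /and3P[n2 n3 /eqP p2].
exists k', k''; rewrite /index_sib p1 p2 eqxx !andbT.
by rewrite eq_sym n1 eq_sym n3 eq_sym n2.
Qed.

Variable v : I -> 'rV[R]_3.
Hypothesis acute : forall k l, k != l -> dot (v k) (v l) <= 3.

(** A part of a gadget has six vertices with three vectors each; as at most eight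
    vectors are long, one of its vertices has two short vectors. *)
Lemma short_pair (g : K) (a : 'I_3) : exists y y' : I,
  [/\ index_sib y y', gadget_of y = g, part_of y = a,
      dot (v y) (v y) <= 60 & dot (v y') (v y') <= 60].
Proof.
have [idx [idxP idx_inj]] := parent_indexing Gs.
pose w (p : 'I_6 * 'I_3) := v (idx (g, a, p.1) p.2).
pose long p := 60 < dot (w p) (w p).
have few : (#|long| <= 8)%N.
  apply: (few_long_vectors (u := w)) => // -[t1 a1] [t2 a2] _ _ ne; apply: acute.
  apply: contra ne => /eqP /= E; have := congr1 (@parent Gs) E; rewrite !idxP => -[tE].
  by move: E; rewrite tE => /idx_inj ->.
have [t tP] : exists t : 'I_6, (#|[set b : 'I_3 | long (t, b)]| <= 1)%N.
  apply/existsP; apply: contraLR few; rewrite negb_exists -ltnNge => /forallP h.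
  apply: (@leq_trans (\sum_(t < 6) 2)%N); first by rewrite sum_nat_const card_ord.
  rewrite -sum1_card -(pair_big_dep xpredT (fun t b => long (t, b)) (fun _ _ => 1%N)) /=.
  apply: leq_sum => t _; rewrite sum1dep_card.
  by have := h t; rewrite -ltnNge.
have /card_gt1P[b [c [bP cP bc]]] : (1 < #|~: [set b : 'I_3 | long (t, b)]|)%N.
  have := cardsC [set b : 'I_3 | long (t, b)]; rewrite card_ord.
  by move: tP; case: #|_| => [|[|n]] // _; case: #|_| => [|[|]].
exists (idx (g, a, t) b), (idx (g, a, t) c); split.
- by rewrite /index_sib !idxP eqxx andbT (inj_eq (idx_inj _)).
- by rewrite /gadget_of idxP.
- by rewrite /part_of idxP.
- by move: bP; rewrite !inE /long -leNgt.
- by move: cP; rewrite !inE /long -leNgt.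
Qed.

End RobustGraph.

Section Bounded.
Variables (R : realType) (K : sgraph) (exposed : K -> 'I_3).
Let Gs := robust 5 exposed.
Let I : finType := 'I_(3 * #|Gs|).

(** A vector with squared norm above 10^12 is excluded by two of its siblings if these
    are below 10^8, and otherwise together with a sibling above 10^8; the gap keeps
    the errors small that are proportional to the products of the siblings. *)
Lemma no_long_vector (eta d beta : R) W (v : I -> 'rV[R]_3) b :
  vector_system (@index_edge K exposed) (@index_sib K exposed) eta d beta W v b ->
  eta * 10 ^+ 9 <= 1 / 100 -> forall k, dot (v k) (v k) <= 10 ^+ 12.
Proof.
move=> vs es k; rewrite leNgt; apply/negP => long.
have [a1 [a2 [p1 p2 p12]]] := other_parts (part_of k).
have [y [y' [Sy gy py ly ly']]] := short_pair (vs_acute vs) (gadget_of k) a1.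
have [z [z' [Sz gz pz lz lz']]] := short_pair (vs_acute vs) (gadget_of k) a2.
have [gy' py'] := sib_gadget Sy; have [gz' pz'] := sib_gadget Sz.
have [k' [k'' [Sk Sk' Skk]]] := siblings k.
have [gk' pk'] := sib_gadget Sk; have [gk'' pk''] := sib_gadget Sk'.
pose D (l : I) := gadget_of l == gadget_of k.
have tri (x x' : I) : D x -> D x' -> part_of x != part_of x' -> index_edge x x'.
  by move=> /eqP gx /eqP gx'; apply: gadget_edge; rewrite gx gx'.
have Dy : D y by rewrite /D gy.
have Dy' : D y' by rewrite /D gy' gy.
have Dz : D z by rewrite /D gz.
have Dz' : D z' by rewrite /D gz' gz.
have [Dk Dk' Dk''] : [/\ D k, D k' & D k''] by rewrite /D gk' gk''.
have yz : part_of y != part_of z by rewrite py pz.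
have two (x x' : I) : D x -> D x' -> part_of x = part_of k -> part_of x' = part_of k ->
    index_sib x x' -> 10 ^+ 8 <= dot (v x') (v x') ->
    dot (v x') (v x') <= dot (v x) (v x) -> False.
  move=> Dx Dx' px px' Sxx' lx' lx; have nxx' : x != x' by case/andP: Sxx'.
  have xy : part_of x != part_of y by rewrite px py.
  have xz : part_of x != part_of z by rewrite px pz.
  exact: (two_long vs es tri Dx Dy Dy' Dz Dz' Sy Sz py' pz' xy xz yz ly ly' lz lz'
    Dx' (etrans px' (esym px)) Sxx' nxx' lx' lx).
have sh (x : I) : D x -> part_of x = part_of k -> index_sib k x -> dot (v x) (v x) <= 10 ^+ 8.
  move=> Dx px Skx; rewrite leNgt; apply/negP => lx.
  have lk : 10 ^+ 8 <= dot (v k) (v k).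
    by apply: le_trans (ltW long); lra.
  have [le|le] := leP (dot (v x) (v x)) (dot (v k) (v k)).
    by apply: (two k x) => //; exact: ltW.
  by apply: (two x k) => //; [rewrite sib_sym | exact: ltW].
have ky : part_of k != part_of y by rewrite py.
have kz : part_of k != part_of z by rewrite pz.
have nkk' : k != k' by case/andP: Sk.
exact: (one_long vs es tri Dk Dy Dy' Dz Dz' Sy Sz py' pz' ky kz yz ly ly' lz lz'
  Dk' Dk'' pk' pk'' Sk Sk' Skk nkk' (sh _ Dk' pk' Sk) (sh _ Dk'' pk'' Sk') (ltW long)).
Qed.

(** A vector x'' with two siblings x, x' has nearly unit length: expand its square
    with respect to the nearly dual bases (x, y, z) and (x', y', z'). *)
Lemma near_unit (x x' x'' y y' z z' : 'rV[R]_3) e : e <= 1 / 10 ^+ 7 ->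
  [/\ `|dot x x' - 1| <= e, `|dot y y' - 1| <= e & `|dot z z' - 1| <= e] ->
  [/\ `|dot x'' x' - 1| <= e & `|dot x x'' - 1| <= e] ->
  [/\ `|dot x y'| <= e, `|dot x z'| <= e, `|dot y x'| <= e & `|dot y z'| <= e] ->
  [/\ `|dot z x'| <= e, `|dot z y'| <= e,  `|dot x'' y'| <= e & `|dot x'' z'| <= e] ->
  [/\ `|dot y x''| <= e & `|dot z x''| <= e] ->
  `|dot x'' x'' - 1| <= 1 / 10 ^+ 5.
Proof.
move=> e7 [xx yy zz] [a b] [xy xz yx yz] [zx zy cy cz] [dy dz].
pose f (i : 'I_3) := tnth [tuple x; y; z] i.
pose f' (i : 'I_3) := tnth [tuple x'; y'; z'] i.
have hf i j : `|dot (f i) (f' j) - (i == j)%:R| <= e.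
  case: i j => [[|[|[|//]]] ?] [[|[|[|//]]] ?]; rewrite /f /f' !(tnth_nth 0) /=;
  by rewrite ?(mulr0n, mulr1n, subr0).
have e0 : 0 <= e := le_trans (normr_ge0 _) xx.
have e6 : e <= 1 / 6 by lra.
have := near_parseval x'' x'' e6 hf.
rewrite !big_ord_recl !big_ord0 /f /f' !(tnth_nth 0) /= !addr0 => H.
have bd t : `|t - 1| <= e -> `|t| <= 2.
  by rewrite !ler_norml => /andP[h1 h2]; apply/andP; split; lra.
have s1 : `|dot x'' x'| + (`|dot x'' y'| + `|dot x'' z'|) <= 3 by have := bd _ a; lra.
have s2 : `|dot x x''| + (`|dot y x''| + `|dot z x''|) <= 3 by have := bd _ b; lra.
have pb (p q : R) : `|p| <= e -> `|q| <= e -> `|p * q| <= e.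
  move=> hp hq; apply: le_trans (normM_le hp hq) _.
  by rewrite -[leRHS]mulr1 ler_wpM2l //; lra.
have h2 := pb _ _ cy dy; have h3 := pb _ _ cz dz; have h1 := pb _ _ a b.
have H2 : 6 * e * (`|dot x'' x'| + (`|dot x'' y'| + `|dot x'' z'|)) *
    (`|dot x x''| + (`|dot y x''| + `|dot z x''|)) <= 54 * e.
  rewrite -mulrA; apply: (@le_trans _ _ (6 * e * (3 * 3))); last by lra.
  by rewrite ler_wpM2l ?mulr_ge0 // ler_pM // !addr_ge0.
move: (le_trans H H2) a b h1 h2 h3; rewrite !ler_norml.
move=> /andP[? ?] /andP[? ?] /andP[? ?] /andP[? ?] /andP[? ?] /andP[? ?].
by apply/andP; split; lra.
Qed.

(** Once no vector is long, W and with it all b are tiny, so that the vectors form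
    a nearly orthonormal representation of the robust graph. *)
Lemma near_orthonormal (eta d beta : R) (v : I -> 'rV[R]_3) b :
  vector_system (@index_edge K exposed) (@index_sib K exposed) eta d beta
    (d *: \sum_k v k) v b ->
  eta * 10 ^+ 9 <= 1 / 100 -> d * (3 * #|Gs|)%:R * 10 ^+ 21 <= 1 ->
  [/\ (forall k l, index_edge k l -> `|dot (v k) (v l)| <= 1 / 10 ^+ 7) &
      forall k l, index_sib k l -> `|dot (v k) (v l) - 1| <= 1 / 10 ^+ 7].
Proof.
move=> vs es dN; have short := no_long_vector vs es.
have /andP[d0 de] := vs_scale vs.
have bsmall k : b k <= 3 / 10 ^+ 9.
  have := vs_slack vs k; have /andP[be0 _] := vs_beta vs k.
  rewrite dotZr dot_sumr ler_norml => /andP[_ h].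
  have h1 : - (10 ^+ 12 * (3 * #|Gs|)%:R) <= \sum_l dot (v k) (v l).
    rewrite mulr_natr -[X in _ *+ X](card_ord (3 * #|Gs|)) -sumr_const -sumrN.
    apply: ler_sum => l _; have := cauchy (v k) (v l).
    have h2 : dot (v k) (v k) * dot (v l) (v l) <= 10 ^+ 12 * 10 ^+ 12.
      by rewrite ler_pM // dot_ge0.
    move=> /le_trans /(_ h2); have : 0 <= 10 ^+ 12 :> R by rewrite exprn_ge0.
    move: (dot _ _) (10 ^+ 12) => x C C0 xC.
    by rewrite leNgt; apply/negP => lt; clear - lt C0 xC; nra.
  have N1 : 1 <= (3 * #|Gs|)%:R :> R.
    by rewrite ler1n; apply: leq_trans (ltn_ord k).
  have h4 : d * dot (v k) (v k) <= d * ((3 * #|Gs|)%:R * 10 ^+ 12).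
    rewrite ler_wpM2l ?(ltW d0) //; apply: le_trans (short k) _.
    by rewrite ler_peMl // exprn_ge0.
  have h5 : d * (- (10 ^+ 12 * (3 * #|Gs|)%:R)) <= d * \sum_l dot (v k) (v l).
    by rewrite ler_wpM2l ?(ltW d0).
  move: dN es h h4 h5 be0; clear; move: (3 * #|Gs|)%:R (\sum_l _) => n S; lra.
split=> k l kl.
  have := vs_edge vs kl; have := bsmall k; have := bsmall l.
  have := vs_ge0 vs k; have := vs_ge0 vs l; rewrite !ler_norml => ? ? ? ? /andP[? ?].
  by apply/andP; split; lra.
have := vs_sib vs kl; have := bsmall k; have := bsmall l.
have := vs_ge0 vs k; have := vs_ge0 vs l; rewrite !ler_norml => ? ? ? ? /andP[? ?].
by apply/andP; split; lra.
Qed.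

End Bounded.

Lemma colorable_of_vectors (R : realType) (G : sgraph) (o : rel G)
    (exposed : peeters o -> 'I_3) (eta d beta : R) v b :
  pair_listing o ->
  vector_system (@index_edge _ exposed) (@index_sib _ exposed) eta d beta
    (d *: \sum_k v k) v b ->
  eta * 10 ^+ 9 <= 1 / 100 ->
  d * (3 * #|robust 5 exposed|)%:R * 10 ^+ 21 <= 1 ->
  colorable 3 G.
Proof.
move=> ho vs es dN; have [edgeP sibP] := near_orthonormal vs es dN.
have [idx [idxP idx_inj]] := parent_indexing (robust 5 exposed).
pose w (x : peeters o) a (i : 'I_3) := idx (x, a, ord0) i.
have Ew x a a' i i' : a != a' -> `|dot (v (w x a i)) (v (w x a' i'))| <= 1 / 10 ^+ 7.
  by move=> aa; apply: edgeP; rewrite /index_edge !idxP /= eqxx aa.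
have Sw x a i i' : i != i' -> `|dot (v (w x a i)) (v (w x a i')) - 1| <= 1 / 10 ^+ 7.
  by move=> ii; apply: sibP; rewrite /index_sib !idxP eqxx andbT (inj_eq (idx_inj _)).
pose i0 : 'I_3 := 0; pose i1 : 'I_3 := 1; pose i2 : 'I_3 := 2.
apply: (@colorable_of_representation R G o (1 / 10 ^+ 5)
  (fun x => v (w x (exposed x) i2)) ho _) => //.
  move=> x; have [a [c [xa xc ac]]] := other_parts (exposed x).
  have [ax cx ca] : [/\ a != exposed x, c != exposed x & c != a].
    by split; rewrite eq_sym.
  apply: (@near_unit R (v (w x (exposed x) i0)) (v (w x (exposed x) i1)) _
    (v (w x a i0)) (v (w x a i1)) (v (w x c i0)) (v (w x c i1)) (1 / 10 ^+ 7)) => //;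
  by split; first [exact: Sw | exact: Ew].
move=> x y xy.
have E : index_edge (w x (exposed x) i2) (w y (exposed y) i2).
  rewrite /index_edge !idxP; change (@robust_adj (peeters o) 5 exposed
    (x, exposed x, ord0) (y, exposed y, ord0)).
  by rewrite /robust_adj xy !eqxx orbT.
by apply: le_trans (edgeP _ _ E) _; lra.
Qed.

(** * Gram matrices corrected by weights on the nonedges *)

Section Weights.
Variables (R : realType) (G : sgraph).
Let I : finType := 'I_(3 * #|G|).
Let J : finType := 'I_(9 * #|nonedges G|).
Let N : R := (3 * #|G|)%:R.

Lemma index_pairP (u : J) : exists k l : I,
  [/\ k != l, nonedge (@parent G k) (@parent G l) & @index_pair G u = [set k; l]].
Proof.
have /imsetP[[k l]] : @index_pair G u \in index_pairs G by exact: enum_valP.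
rewrite inE /= => kl E; exists k, l; split=> //.
by apply: contraTneq kl => ->; rewrite /nonedge eqxx.
Qed.

Lemma card_index_pair (u : J) : #|@index_pair G u| = 2.
Proof. by have [k [l [kl _ ->]]] := index_pairP u; rewrite cards2 kl. Qed.

Lemma index_pair_nonedge (u : J) (k l : I) : k != l ->
  k \in @index_pair G u -> l \in @index_pair G u -> nonedge (@parent G k) (@parent G l).
Proof.
have [k' [l' [_ ne ->]]] := index_pairP u; rewrite !inE => kl.
case/orP=> /eqP kE /orP[] /eqP lE; move: kl; rewrite ?kE ?lE ?eqxx // => _.
by move: ne; rewrite /nonedge eq_sym adj_sym.
Qed.

(** The matrix K divided by s. *)
Definition kappa (delta : R) (k : I) (u : J) : R :=
  if k \in @index_pair G u then 1 else delta.

Variables (y : J -> R) (delta zeta eta : R) (v : I -> 'rV[R]_3).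
Hypothesis y_ge0 : forall u, 0 <= y u.

Let inc k u : R := (k \in @index_pair G u)%:R.
Let r k := \sum_u inc k u * y u.
Let T := \sum_u y u.
Let chi k l := \sum_u inc k u * inc l u * y u.
Let w k l := \sum_u kappa delta k u * kappa delta l u * y u.
(* b k collects the contributions of delta to the row of k, and half of the term that
   all entries of w have in common. *)
Let b k := delta * (1 - delta) * r k + delta ^+ 2 / 2 * T.

Let inc_sum u : \sum_k inc k u = 2.
Proof.
transitivity (#|@index_pair G u|%:R : R); last by rewrite card_index_pair.
rewrite -natr_sum -sum1_card [in RHS]big_mkcond /=.
by congr (_%:R); apply: eq_bigr => k _; case: (_ \in _).
Qed.

Lemma weight_split k l : w k l = (1 - delta) ^+ 2 * chi k l + b k + b l.
Proof.
rewrite /w /b /chi /r /T; rewrite !mulr_sumr -!big_split /=; apply: eq_bigr => u _.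
rewrite /kappa /inc; case: (k \in _); case: (l \in _); rewrite /= ?mulr1n ?mulr0n; lra.
Qed.

Lemma chi_sum k : \sum_l chi k l = 2 * r k.
Proof.
rewrite /chi exchange_big mulr_sumr; apply: eq_bigr => u _.
rewrite -mulr_suml -mulr_sumr mulrA [2 * _]mulrC; congr (_ * _ * _).
exact: inc_sum.
Qed.

Lemma chi_diag k : chi k k = r k.
Proof.
by apply: eq_bigr => u _; rewrite /inc; case: (_ \in _); rewrite ?mul1r ?mul0r.
Qed.

Lemma chi_linked k l : k != l -> ~~ nonedge (@parent G k) (@parent G l) -> chi k l = 0.
Proof.
move=> kl ne; apply: big1 => u _; rewrite /inc.
case: (boolP (k \in _)) => [ku|_]; last by rewrite !mul0r.
case: (boolP (l \in _)) => [lu|_]; last by rewrite mulr0 mul0r.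
by rewrite (index_pair_nonedge kl ku lu) in ne.
Qed.

Lemma r_sum : \sum_k r k = 2 * T.
Proof.
rewrite /r exchange_big mulr_sumr; apply: eq_bigr => u _.
by rewrite -mulr_suml inc_sum.
Qed.

Let T_ge0 : 0 <= T. Proof. by apply: sumr_ge0. Qed.
Let r_ge0 k : 0 <= r k.
Proof. by apply: sumr_ge0 => u _; rewrite mulr_ge0 // ler0n. Qed.
Let r_le k : r k <= T.
Proof.
apply: ler_sum => u _; rewrite /inc; case: (_ \in _); first by rewrite mul1r.
by rewrite mul0r.
Qed.

Let mu := 1 + (N - 3) * delta.
Let d := delta / mu.
Let theta := delta ^+ 2 * T.
Let beta := theta * (2 + mu) / (2 * mu).
Let V := \sum_k v k.
Let a k := \sum_(l | l != k) (dot (v k) (v l) + w k l).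

Hypothesis G_gt0 : (0 < #|G|)%N.
Hypothesis delta_gt0 : 0 < delta.
Hypothesis zeta_eta : zeta <= eta.
Hypothesis delta_eta : 3 * N * delta <= eta.
Hypothesis eta_small : eta <= 1 / 10.
Hypothesis v_gram : forall k l, k != l ->
  `|dot (v k) (v l) - (mxA R G k l - w k l)| <= zeta.

Let N3 : 3 <= N.
Proof. by rewrite /N ler_nat; move: G_gt0; case: #|G| => // n; rewrite mulnS leq_addr. Qed.

Let Nd : N * delta <= 1 / 10. Proof. have ? := delta_eta; have ? := eta_small; have ? := N3; have ? := delta_gt0; nra. Qed.
Let delta1 : delta <= 1 / 30. Proof. have ? := Nd; have ? := N3; have ? := delta_gt0; nra. Qed.
Let mu1 : 1 <= mu.
Proof. have ? := N3; have ? := delta_gt0; rewrite /mu lerDl mulr_ge0 //; lra. Qed.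
Let mu2 : mu <= 11 / 10.
Proof. have ? := Nd; have ? := delta_gt0; rewrite /mu; lra. Qed.
Let mu0 : mu != 0. Proof. by have ? := mu1; rewrite gt_eqF //; lra. Qed.
Let d_gt0 : 0 < d. Proof. by have ? := mu1; rewrite divr_gt0 //; lra. Qed.
Let d_le : d <= delta.
Proof.
have ? := mu1; have ? := delta_gt0; rewrite /d ler_pdivrMr; first by nra.
lra.
Qed.
Let theta_ge0 : 0 <= theta. Proof. by rewrite mulr_ge0 ?sqr_ge0. Qed.

Lemma w_ge0 k l : 0 <= w k l.
Proof.
apply: sumr_ge0 => u _; rewrite mulr_ge0 // mulr_ge0 //.
  by rewrite /kappa; case: ifP => // _; apply: ltW.
by rewrite /kappa; case: ifP => // _; apply: ltW.
Qed.

Lemma mxA_bounds k l : 0 <= mxA R G k l <= 2.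
Proof. by rewrite mxE; do ?case: ifP => _; apply/andP; split; lra. Qed.

Lemma a_bound k : `|a k| <= 3 * N.
Proof.
apply: le_trans (ler_norm_sum _ _ _) _.
apply: (@le_trans _ _ (\sum_(l : I) 3)); last first.
  by rewrite sumr_const card_ord mulr_natr.
rewrite [leRHS](bigID (fun l => l != k)) /= -[leLHS]addr0; apply: lerD; last first.
  exact: sumr_ge0.
apply: ler_sum => l lk; have kl : k != l by rewrite eq_sym.
have := v_gram kl; have := mxA_bounds k l; have := zeta_eta; have := eta_small.
rewrite !ler_norml => ? ? /andP[? ?] /andP[? ?]; apply/andP; split; lra.
Qed.

Lemma b_sum : \sum_k b k = 2 * (1 - delta) * delta * T + N * theta / 2.
Proof.
rewrite /b big_split /= -mulr_sumr r_sum sumr_const card_ord -[_ *+ (3 * #|G|)]mulr_natr -/N /theta.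
by field.
Qed.

(** Summing the Gram entries of one row expresses b through the vectors: every
    column of K has exactly two large entries, so the row sums of the weights are
    multiples of r. *)
Lemma slack_eq k : b k - (d * dot (v k) (v k) - dot (v k) (d *: V) - beta) = d * a k.
Proof.
have aE : a k = dot (v k) V - dot (v k) (v k)
     + ((1 - delta) ^+ 2 * r k + (N - 2) * b k + \sum_l b l).
  have h (F : I -> R) : \sum_(l | l != k) F l = \sum_l F l - F k.
    by rewrite [X in _ = X - _](bigD1 k) //= addrAC subrr add0r.
  rewrite /a h big_split /= -dot_sumr -/V weight_split chi_diag.
  rewrite (eq_bigr (fun l => (1 - delta) ^+ 2 * chi k l + b k + b l)); last first.
    by move=> l _; exact: weight_split.
  rewrite [X in _ + X - _]big_split /= [X in _ + (X + _) - _]big_split /=.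
  rewrite -mulr_sumr chi_sum sumr_const card_ord.
  by rewrite -[_ *+ (3 * #|G|)]mulr_natr -/N; ring.
have dmu : d * mu = delta by rewrite /d divfK.
have bmu : beta * mu = theta * (2 + mu) / 2 by rewrite /beta; field.
apply: (mulIf mu0); rewrite dotZr.
transitivity (b k * mu - d * mu * dot (v k) (v k) + d * mu * dot (v k) V + beta * mu).
  by ring.
have -> : d * a k * mu = delta * a k by rewrite -dmu; ring.
rewrite dmu bmu aE b_sum /theta /b /mu; lra.
Qed.

(** Summing the formula for b over k; the term d times the sum of b is of order
    theta, and is absorbed by 2 beta. *)
Lemma energy : d ^+ 2 * \sum_k dot (v k) (v k) - d ^+ 2 * (3 * N * N) <=
  dot (d *: V) (d *: V) + 2 * beta.
Proof.
have S : \sum_k b k - (d * \sum_k dot (v k) (v k) - dot V (d *: V) - N * beta) = d * \sum_k a k.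
  have : \sum_k (b k - (d * dot (v k) (v k) - dot (v k) (d *: V) - beta)) = \sum_k d * a k.
    by apply: eq_bigr => k _; exact: slack_eq.
  rewrite -[in RHS]mulr_sumr => <-; rewrite !sumrB -mulr_sumr -dot_suml.
  by rewrite sumr_const card_ord -[_ *+ (3 * #|G|)]mulr_natr -/N [beta * N]mulrC.
have A : - (3 * N * N) <= \sum_k a k.
  have : `|\sum_k a k| <= 3 * N * N.
    apply: le_trans (ler_norm_sum _ _ _) _.
    rewrite mulr_natr -[X in _ *+ X](card_ord (3 * #|G|)) -sumr_const.
    by apply: ler_sum => k _; exact: a_bound.
  by rewrite ler_norml => /andP[].
have P : 0 <= 2 * beta - N * d * beta - d * \sum_k b k.
  have -> : 2 * beta - N * d * beta - d * \sum_k b k =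
     theta / (2 * mu) * ((2 + mu) * (2 - N * delta / mu) - 4 * (1 - delta) - N * delta).
    rewrite b_sum /beta /d /theta; field; rewrite mu0 //.
  have ? := mu1; have ? := mu2; have ? := Nd; have ? := N3.
  have ? := delta_gt0; have h : N * delta / mu <= 1 / 10.
    rewrite ler_pdivrMr; last lra.
    by apply: le_trans Nd _; lra.
  apply: mulr_ge0; first by rewrite divr_ge0 ?mulr_ge0 //; lra.
  have : 3 * (19 / 10) <= (2 + mu) * (2 - N * delta / mu) by rewrite ler_pM //; lra.
  lra.
have A2 : d ^+ 2 * - (3 * N * N) <= d ^+ 2 * \sum_k a k by rewrite ler_wpM2l ?sqr_ge0.
have E : d * (\sum_k b k) - d ^+ 2 * \sum_k dot (v k) (v k) + dot (d *: V) (d *: V)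
    + N * d * beta = d ^+ 2 * \sum_k a k.
  have := congr1 (fun t => d * t) S; rewrite /= dotZl => h.
  by rewrite expr2 -[RHS]mulrA -h; ring.
lra.
Qed.

Theorem weights_vector_system :
  vector_system (fun k l : I => adj (@parent G k) (@parent G l))
    (fun k l : I => (k != l) && (@parent G k == @parent G l)) eta d beta (d *: V) v b.
Proof.
have N3' := N3; have Nd' := Nd; have de := delta_eta; have es := eta_small.
have dp := delta_gt0; have d1 := delta1; have dle := d_le; have dp' := d_gt0.
have m1 := mu1; have ze := zeta_eta.
have link k l : k != l -> ~~ nonedge (@parent G k) (@parent G l) ->
    `|dot (v k) (v l) + b k + b l - mxA R G k l| <= eta.
  move=> kl ne; have := v_gram kl; rewrite weight_split chi_linked // mulr0 add0r.
  by move=> h; apply: le_trans ze; apply: le_trans h; rewrite le_eqVlt; apply/orP; left;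
    apply/eqP; congr `|_|; ring.
have b_lo k : theta / 2 <= b k.
  rewrite /b /theta; have : 0 <= delta * (1 - delta) * r k.
    by rewrite mulr_ge0 // mulr_ge0 //; lra.
  lra.
have b0 k : 0 <= b k by apply: le_trans (b_lo k); rewrite divr_ge0.
split=> //.
- move=> k l kl; rewrite -[X in `|X|]subr0.
  have pkl : @parent G k != @parent G l by apply: contraTneq kl => ->; rewrite adj_irrefl.
  have nkl : k != l by apply: contraNneq pkl => ->.
  have := link k l nkl; rewrite /nonedge pkl kl /= mxE (negbTE nkl) (negbTE pkl) kl.
  exact.
- move=> k l /andP[kl /eqP pkl]; have := link k l kl.
  rewrite /nonedge pkl eqxx /= mxE (negbTE kl) pkl eqxx; exact.
- move=> k l kl; have := v_gram kl; have := mxA_bounds k l; have := w_ge0 k l.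
  rewrite ler_norml => ? /andP[? ?] /andP[? ?]; lra.
- move=> k; rewrite slack_eq normrM (ger0_norm (ltW dp')).
  apply: (@le_trans _ _ (delta * (3 * N))); last by lra.
  by rewrite ler_pM ?(ltW dp') // a_bound.
- move=> k; apply/andP; split.
    by rewrite /beta divr_ge0 ?mulr_ge0 //; lra.
  apply: (@le_trans _ _ (theta * 3 / 2)); last by have := b_lo k; lra.
  rewrite /beta ler_pdivrMr; last by lra.
  have : theta * (2 + mu) <= theta * (3 * mu) by rewrite ler_wpM2l //; lra.
  lra.
- move=> k l; apply: (@le_trans _ _ theta); last by have := b_lo l; lra.
  apply: (@le_trans _ _ (delta * (delta * T))); last by rewrite /theta; lra.
  rewrite ler_pM ?(ltW dp') // /b.
  have : delta * (1 - delta) * r k <= delta * (1 - delta) * T.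
    by rewrite ler_wpM2l // mulr_ge0 //; lra.
  have : 0 <= delta ^+ 2 * T by rewrite mulr_ge0 ?sqr_ge0.
  lra.
- move=> k l kl; apply: le_trans energy; rewrite lerB //.
    rewrite ler_wpM2l ?sqr_ge0 // [leRHS](bigD1 k) //= lerD2l.
    rewrite (bigD1 l) /=; last by rewrite eq_sym.
    by rewrite lerDl sumr_ge0 // => j _; exact: dot_ge0.
  have -> : d ^+ 2 * (3 * N * N) = 3 * ((N * d) * (N * d)) by ring.
  have h : N * d <= N * delta by rewrite ler_wpM2l //; lra.
  have h0 : 0 <= N * d by rewrite mulr_ge0 //; lra.
  have : (N * d) * (N * d) <= (N * delta) * 1 by rewrite ler_pM //; lra.
  lra.
- rewrite dp' /=; apply: le_trans dle _.
  have : 3 * delta <= N * delta by rewrite ler_wpM2r //; lra.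
  lra.
Qed.

End Weights.

(** * The inverse of the pivot block is nearly diagonal *)

Section InverseWeights.
Variable R : realType.

(** One bounded entry of L P^-1 L^T bounds the total mass of the nonnegative
    matrix Y = s^2 P^-1, because all entries of L / s are at least delta / 2.  The
    diagonal entries of P are then at least s^2 / T, so that the equation P Y = s^2 I
    makes the off-diagonal entries of Y of order s^-2. *)
Lemma inverse_weights nI nJ (P : 'M[R]_nJ) (L : 'M[R]_(nI, nJ))
    (kap : 'I_nI -> 'I_nJ -> R) (s delta h : R) :
  let T := 252 / delta ^+ 2 in
  0 < delta -> 0 < h -> 1 <= s -> 2 * h <= s * delta ->
  12 * nJ%:R ^+ 2 * T ^+ 2 + 3 * T <= s ->
  psd P -> P \in unitmx ->
  (forall u v, u != v -> - (3 * h) <= P u v <= 0) ->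
  (forall k u, delta <= kap k u <= 1) ->
  (forall k u, `|L k u - s * kap k u| <= h) ->
  (exists k l, (L *m invmx P *m L^T) k l <= 63) ->
  forall k l, `|(L *m invmx P *m L^T) k l
     - \sum_u kap k u * kap l u * (s ^+ 2 * invmx P u u)| <= h.
Proof.
move=> T d0 h0 s1 hs sT Pp Pu Pneg kapP Lk [k0 [l0 short]] k l.
have s0 : 0 < s by lra.
pose Y u v := s ^+ 2 * invmx P u v.
pose lam k u := L k u / s.
have Y0 u v : 0 <= Y u v.
  rewrite mulr_ge0 ?sqr_ge0 // stieltjes // => i j ij.
  by case/andP: (Pneg i j ij).
have wE i j : (L *m invmx P *m L^T) i j = \sum_u \sum_v lam i u * Y u v * lam j v.
  rewrite mxE; under eq_bigr => v _ do rewrite !mxE mulr_suml.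
  rewrite exchange_big; apply: eq_bigr => u _; apply: eq_bigr => v _.
  by rewrite /lam /Y; field; rewrite gt_eqF.
have lamk i u : `|lam i u - kap i u| <= h / s.
  have -> : lam i u - kap i u = (L i u - s * kap i u) / s by rewrite /lam; field; rewrite gt_eqF.
  by rewrite normrM normfV (ger0_norm (ltW s0)) ler_wpM2r ?invr_ge0 ?(ltW s0).
have hs1 : h / s <= delta / 2 by rewrite ler_pdivrMr //; lra.
have hs0 : 0 < h / s by rewrite divr_gt0.
have lam_lo i u : delta / 2 <= lam i u.
  have := lamk i u; rewrite ler_norml => /andP[]; case/andP: (kapP i u); lra.
have lam_hi i u : lam i u <= 2.
  by have := lamk i u; rewrite ler_norml => /andP[]; case/andP: (kapP i u); lra.
have lam0 i u : 0 <= lam i u by have := lam_lo i u; lra.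
have mass : \sum_u \sum_v Y u v <= T.
  have : (delta / 2) ^+ 2 * (\sum_u \sum_v Y u v) <= 63.
    apply: le_trans short; rewrite wE mulr_sumr; apply: ler_sum => u _.
    rewrite mulr_sumr; apply: ler_sum => v _.
    rewrite expr2 mulrAC; apply: ler_pM; last exact: lam_lo.
    - by rewrite mulr_ge0 //; lra.
    - lra.
    - by rewrite ler_wpM2r.
  by rewrite /T ler_pdivlMr ?exprn_gt0 // => ?; lra.
have T0 : 0 < T by rewrite divr_gt0 // exprn_gt0.
have Yle u v : Y u v <= T.
  apply: le_trans mass; rewrite (bigD1 u) //= (bigD1 v) //= -addrA lerDl.
  by rewrite addr_ge0 // sumr_ge0 // => i _; rewrite sumr_ge0.
have colle v : \sum_u Y u v <= T.
  apply: le_trans mass; apply: ler_sum => u _; rewrite (bigD1 v) //= lerDl.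
  by rewrite sumr_ge0.
have PY u v : \sum_t P u t * Y t v = s ^+ 2 * (u == v)%:R.
  transitivity (s ^+ 2 * (P *m invmx P) u v); last by rewrite mulmxV // mxE.
  by rewrite mxE mulr_sumr; apply: eq_bigr => t _; rewrite /Y mulrCA.
have PYoff u v : 0 <= - (\sum_(t | t != u) P u t * Y t v) <= 3 * h * T.
  rewrite -sumrN; apply/andP; split.
    apply: sumr_ge0 => t tu; rewrite -mulNr mulr_ge0 // oppr_ge0.
    have ut : u != t by rewrite eq_sym.
    by case/andP: (Pneg u t ut).
  apply: (@le_trans _ _ (\sum_(t | t != u) 3 * h * Y t v)).
    apply: ler_sum => t tu; rewrite -mulNr ler_wpM2r // lerNl.
    have ut : u != t by rewrite eq_sym.
    by case/andP: (Pneg u t ut).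
  rewrite -mulr_sumr ler_wpM2l ?mulr_ge0 ?(ltW h0) //; apply: le_trans (colle v).
  by rewrite [leRHS](bigD1 u) //= lerDr.
have diag u : s ^+ 2 <= P u u * Y u u.
  have := PY u u; rewrite eqxx mulr1 (bigD1 u) //= => E.
  by case/andP: (PYoff u u); lra.
have off u v : u != v -> s ^+ 2 * Y u v <= 3 * h * T ^+ 2.
  move=> uv; have := PY u v; rewrite (negbTE uv) mulr0 (bigD1 u) //= => E.
  have e1 : P u u * Y u v <= 3 * h * T by case/andP: (PYoff u v); lra.
  apply: (@le_trans _ _ (P u u * Y u u * Y u v)); first by rewrite ler_wpM2r.
  rewrite mulrAC; apply: le_trans (_ : 3 * h * T * Y u u <= _).
    by rewrite ler_wpM2r.
  have c0 : 0 <= 3 * h * T by rewrite mulr_ge0 ?(ltW T0) // mulr_ge0 // ltW.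
  by rewrite [T ^+ 2]expr2 [leRHS]mulrA; exact: ler_wpM2l c0 _ _ (Yle u u).
rewrite wE -sumrB.
have row u : `|(\sum_v lam k u * Y u v * lam l v) - kap k u * kap l u * Y u u| <=
    nJ%:R * (12 * h * T ^+ 2 / s ^+ 2) + 3 * h / s * Y u u.
  rewrite (bigD1 u) //= addrAC addrC; apply: le_trans (ler_normD _ _) _.
  apply: lerD.
    apply: le_trans (ler_norm_sum _ _ _) _.
    apply: (@le_trans _ _ (\sum_(v < nJ) 12 * h * T ^+ 2 / s ^+ 2)); last first.
      by rewrite sumr_const card_ord -[leLHS]mulr_natl.
    have c0 : 0 <= 12 * h * T ^+ 2 / s ^+ 2.
      by rewrite divr_ge0 ?sqr_ge0 // mulr_ge0 ?sqr_ge0 // mulr_ge0 // ltW.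
    rewrite [leRHS](bigID (fun v => v != u)) /= -[leLHS]addr0; apply: lerD; last first.
      by apply: sumr_ge0.
    apply: ler_sum => v vu; rewrite ger0_norm; last first.
      by rewrite mulr_ge0 // mulr_ge0.
    rewrite ler_pdivlMr ?exprn_gt0 //.
    have o := off u v; rewrite eq_sym in o; have {}o := o vu.
    have a1 := lam_lo k u; have a2 := lam_lo l v; have a3 := lam_hi k u; have a4 := lam_hi l v.
    have a5 : lam k u * lam l v <= 2 * 2 by rewrite ler_pM.
    have a6 : lam k u * lam l v * (s ^+ 2 * Y u v) <= 2 * 2 * (3 * h * T ^+ 2).
      by apply: ler_pM => //; rewrite mulr_ge0 ?sqr_ge0.
    lra.
  have -> : lam k u * Y u u * lam l u - kap k u * kap l u * Y u u =
      (lam k u * lam l u - kap k u * kap l u) * Y u u by ring.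
  rewrite normrM (ger0_norm (Y0 u u)) ler_wpM2r //.
  have -> : lam k u * lam l u - kap k u * kap l u =
     (lam k u - kap k u) * lam l u + kap k u * (lam l u - kap l u) by ring.
  apply: le_trans (ler_normD _ _) _.
  have b1 : `|lam l u| <= 2.
    by rewrite ger0_norm //; have := lam_lo l u; lra.
  have b2 : `|kap k u| <= 1.
    by case/andP: (kapP k u) => ? ?; rewrite ger0_norm //; lra.
  have c1 : `|(lam k u - kap k u) * lam l u| <= h / s * 2 by exact: normM_le.
  have c2 : `|kap k u * (lam l u - kap l u)| <= 1 * (h / s) by exact: normM_le.
  lra.
apply: le_trans (ler_norm_sum _ _ _) _.
apply: le_trans (ler_sum _ (fun u _ => row u)) _.
rewrite big_split /= sumr_const card_ord -mulr_sumr -[_ *+ nJ]mulr_natl.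
have YT : \sum_u Y u u <= T.
  by apply: le_trans mass; apply: ler_sum => u _; rewrite (bigD1 u) //= lerDl sumr_ge0.
have z0 : 0 < s^-1 by rewrite invr_gt0.
have z1 : s^-1 <= 1 by rewrite invf_le1.
apply: (@le_trans _ _ (h * ((12 * nJ%:R ^+ 2 * T ^+ 2 + 3 * T) * s^-1))); last first.
  by rewrite -[leRHS]mulr1 ler_wpM2l ?(ltW h0) // ler_pdivrMr // mul1r.
have e1 : 3 * h / s * (\sum_u Y u u) <= 3 * h / s * T.
  by apply: ler_wpM2l => //; apply: divr_ge0; [apply: mulr_ge0 => // |]; exact: ltW.
have e2 : (12 * nJ%:R ^+ 2 * T ^+ 2 * h * s^-1) * s^-1 <= (12 * nJ%:R ^+ 2 * T ^+ 2 * h * s^-1) * 1.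
  apply: ler_wpM2l => //; apply: mulr_ge0; last exact: ltW.
  by apply: mulr_ge0; [rewrite mulr_ge0 ?sqr_ge0 // mulr_ge0 ?sqr_ge0 | exact: ltW].
move: e1 e2; rewrite -exprVn; lra.
Qed.

End InverseWeights.

(** * From low rank to colourings *)

Lemma frobenius_entry (R : realType) n (H : 'M[R]_n) i j : `|H i j| <= frobenius H.
Proof.
rewrite -sqrtr_sqr; apply: ler_wsqrtr; rewrite (bigD1 i) //= (bigD1 j) //= -addrA.
rewrite lerDl addr_ge0 ?sumr_ge0 // => [k _|k _]; first exact: sqr_ge0.
by apply: sumr_ge0 => l _; exact: sqr_ge0.
Qed.

(** The Schur complement of the top left block is a Gram matrix of vectors in space.
    The number 252 is 4 times 63, where 63 bounds the product w(k,l) of two indices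
    with short vectors, and where 4 comes from L >= s delta / 2. *)
Theorem colorable_of_low_rank (R : realType) (G : sgraph) (o : rel G)
    (exposed : peeters o -> 'I_3) :
  let Gs := robust 5 exposed in
  let m := #|nonedges Gs| in
  let N := (9 * m + 3 * #|Gs|)%N in
  pair_listing o -> (0 < #|Gs|)%N ->
  forall (s delta eps phat : R) (H : 'M[R]_N) (d : 'rV[R]_N),
  let h := phat * eps in
  let T := 252 / delta ^+ 2 in
  0 < delta -> 0 < h -> h * 10 ^+ 12 <= 1 ->
  delta * (3 * #|Gs|)%:R * 10 ^+ 21 <= 1 ->
  1 <= s -> 2 * h <= s * delta ->
  12 * (9 * m)%:R ^+ 2 * T ^+ 2 + 3 * T <= s ->
  H \is symmetricmx -> frobenius H <= h ->
  psd (mxB Gs s delta eps phat + diag_mx d + H) ->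
  (\rank (mxB Gs s delta eps phat + diag_mx d + H)%R <= 9 * m + 3)%N ->
  colorable 3 G.
Proof.
move=> Gs m N ho G0 s delta eps phat H d h T d0 h0 h12 dN s1 hs sT /symmetricmxP HT Hh.
set M := (X in psd X) => Mp Mr.
have s0 : 0 < s by lra.
have Hle i j : `|H i j| <= h by apply: le_trans (frobenius_entry H i j) Hh.
have MT := psd_tr Mp.
pose P := ulsubmx M; pose L := dlsubmx M; pose Z := drsubmx M.
have ME : M = block_mx P L^T L Z.
  by rewrite -[LHS]submxK; congr block_mx; rewrite /L trmx_dlsub MT.
have entry i j : M i j = mxB Gs s delta eps phat i j + diag_mx d i j + H i j.
  by rewrite /M !addmxE.
have PE u v : u != v -> P u v = - 2 * h + H (lshift _ u) (lshift _ v).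
  move=> uv; rewrite /P 2!mxE entry /mxB block_mxEul !mxE (inj_eq (@lshift_inj _ _)).
  by rewrite (negbTE uv) mulr0n addr0 mulrA.
have LE k u : L k u = s * kappa delta k u + H (rshift _ k) (lshift _ u).
  rewrite /L 2!mxE entry /mxB block_mxEdl !mxE eq_rlshift mulr0n addr0 /kappa.
  by case: ifP => _; rewrite ?mulr1.
have ZE k l : k != l -> Z k l = mxA R Gs k l + H (rshift _ k) (rshift _ l).
  move=> kl; rewrite /Z 2!mxE entry /mxB block_mxEdr [diag_mx _ _ _]mxE.
  by rewrite (inj_eq (@rshift_inj _ _)) (negbTE kl) mulr0n addr0.
have hneg u v : u != v -> - (3 * h) <= P u v <= 0.
  move=> uv; rewrite PE //; have := Hle (lshift _ u) (lshift _ v).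
  by rewrite ler_norml => /andP[? ?]; apply/andP; split; lra.
have N1 : 1 <= (3 * #|Gs|)%:R :> R by rewrite ler1n muln_gt0.
have dle1 : delta <= 1 / 10.
  have : delta * 1 <= delta * (3 * #|Gs|)%:R by rewrite ler_wpM2l // ltW.
  lra.
have kapP (k : 'I_(3 * #|Gs|)) (u : 'I_(9 * #|nonedges Gs|)) : delta <= kappa delta k u <= 1.
  by rewrite /kappa; case: ifP => _; apply/andP; clear - d0 dle1; split; lra.
have Lk k u : `|L k u - s * kappa delta k u| <= h.
  by rewrite LE addrAC subrr add0r.
have Lpos k u : 0 < L k u.
  have := Lk k u; rewrite ler_norml => /andP[+ _].
  have : s * delta <= s * kappa delta k u.
    by rewrite ler_wpM2l ?(ltW s0) //; case/andP: (kapP k u).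
  lra.
have G3 : (0 < 3 * #|Gs|)%N by rewrite muln_gt0.
have Pu : P \in unitmx.
  apply: (corner_unit (Z := Z) G3 _ _ Lpos); first by rewrite -ME.
  by move=> u v uv; case/andP: (hneg u v uv).
have PT : P^T = P by move: MT; rewrite ME tr_block_mx => /eq_block_mx[].
pose S := Z - L *m invmx P *m L^T.
have [Pp Sp] : psd P /\ psd S by apply/(psd_schur L Z Pu PT); rewrite -ME.
have Sr : (\rank S <= 3)%N.
  by move: Mr; rewrite -/M ME schur_rank // leq_add2l.
have [V VE] := psd_gram Sp Sr.
pose v k := row k V.
have vE k l : dot (v k) (v l) = Z k l - (L *m invmx P *m L^T) k l.
  by rewrite -dot_mulmx -VE submxE.
have Hlow k l : k != l -> `|dot (v k) (v l) - (mxA R Gs k l - (L *m invmx P *m L^T) k l)| <= h.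
  move=> kl; rewrite vE ZE // (_ : _ - _ = H (rshift _ k) (rshift _ l)) //; ring.
have Pinv i j : 0 <= invmx P i j.
  by apply: stieltjes => // u w uw; case/andP: (hneg u w uw).
have w0 k l : 0 <= (L *m invmx P *m L^T) k l.
  rewrite mxE; apply: sumr_ge0 => u _; rewrite mulr_ge0 //; last by rewrite mxE ltW.
  by rewrite mxE; apply: sumr_ge0 => w _; rewrite mulr_ge0 // ltW.
have acute k l : k != l -> dot (v k) (v l) <= 3.
  move=> kl; have := Hlow k l kl; have := mxA_bounds R k l; have := w0 k l.
  by rewrite ler_norml => ? /andP[? ?] /andP[? ?]; lra.
have [k0 [l0 short]] : exists k l, (L *m invmx P *m L^T) k l <= 63.
  have [k [l [/andP[kl _] _ _ hk hl]]] := short_pair acute (gadget_of (Ordinal G3)) 0.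
  exists k, l; have := Hlow k l kl; have := mxA_bounds R k l.
  have : - 60 <= dot (v k) (v l).
    have := cauchy (v k) (v l).
    have h2 : dot (v k) (v k) * dot (v l) (v l) <= 60 * 60.
      by rewrite ler_pM ?dot_ge0.
    move=> /le_trans /(_ h2); move: (dot _ _) => x xC; clear - xC.
    by rewrite leNgt; apply/negP => lt; nra.
  by rewrite ler_norml => ? /andP[? ?] /andP[? ?]; lra.
have W := @inverse_weights R _ _ P L (kappa delta) s delta h d0 h0 s1 hs sT Pp Pu hneg kapP Lk
  (ex_intro _ k0 (ex_intro _ l0 short)).
pose y u := s ^+ 2 * invmx P u u.
have y0 u : 0 <= y u by rewrite mulr_ge0 ?sqr_ge0.
pose eta := 2 * h + 3 * (3 * #|Gs|)%:R * delta.
have gram k l : k != l -> `|dot (v k) (v l) - (mxA R Gs k l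
    - \sum_u kappa delta k u * kappa delta l u * y u)| <= 2 * h.
  move=> kl; have := Hlow k l kl; have := W k l; rewrite -/y !ler_norml.
  move=> /andP[g1 g2] /andP[g3 g4]; apply/andP.
  by clear - g1 g2 g3 g4; split; lra.
have z1 : 2 * h <= eta by rewrite /eta lerDl !mulr_ge0 // ltW.
have z2 : 3 * (3 * #|Gs|)%:R * delta <= eta by rewrite /eta lerDr mulr_ge0 // ltW.
have z3 : eta * 10 ^+ 9 <= 1 / 100 by rewrite /eta; clear - h0 h12 d0 dN; lra.
have z4 : eta <= 1 / 10 by clear - z3; lra.
have vs := weights_vector_system y0 G0 d0 z1 z2 z4 gram.
apply: (colorable_of_vectors ho vs z3).
apply: le_trans dN; rewrite ler_wpM2r ?exprn_ge0 // ler_wpM2r //.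
rewrite ler_pdivrMr.
  by rewrite ler_peMr ?(ltW d0) // lerDl mulr_ge0 ?(ltW d0) // subr_ge0 ler_nat leq_pmulr.
by rewrite ltr_pwDl // mulr_ge0 ?(ltW d0) // subr_ge0 ler_nat leq_pmulr.
Qed.

(** * A diagonal matrix with a rank one perturbation *)

Lemma sum_delta (R : realType) n (u : 'I_n) (F : 'I_n -> R) :
  \sum_t (u == t)%:R * F t = F u.
Proof.
rewrite (bigD1 u) //= eqxx mul1r big1 ?addr0 // => t.
by rewrite eq_sym => /negbTE->; rewrite mul0r.
Qed.

Section RankOnePerturbation.
Variables (R : realType) (J : nat) (x : 'I_J -> R) (s c : R).
Hypothesis x_bounds : forall u, 1 <= x u <= 2.
Hypotheses (s_gt0 : 0 < s) (c_ge0 : 0 <= c) (s_large : 4 * c * J%:R <= s ^+ 2).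

(** The block D + Diag(d) for the choice d_u = s^2 / x_u - c, where c = 2 phat eps. *)
Definition pivot_mx : 'M[R]_J := \matrix_(u, v) ((u == v)%:R * (s ^+ 2 / x u) - c).

Let g := c / (s ^+ 2 - c * \sum_u x u).
Let X0 u : 0 < x u. Proof. by case/andP: (x_bounds u) => ? ?; lra. Qed.
Let sum_le : \sum_u x u <= 2 * J%:R.
Proof.
rewrite mulr_natr -[X in _ *+ X](card_ord J) -sumr_const.
by apply: ler_sum => u _; case/andP: (x_bounds u).
Qed.
Let S0 : 0 < s ^+ 2. Proof. by rewrite exprn_gt0. Qed.
Let denom : s ^+ 2 / 2 <= s ^+ 2 - c * \sum_u x u.
Proof.
have h := ler_wpM2l c_ge0 sum_le; have ? := s_large; lra.
Qed.
Let denom0 : 0 < s ^+ 2 - c * \sum_u x u.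
Proof. have ? := denom; have ? := S0; lra. Qed.

Let g_ge0 : 0 <= g. Proof. by rewrite divr_ge0 // ltW. Qed.
Let g_le : g <= 2 * c / s ^+ 2.
Proof.
rewrite /g ler_pdivrMr // mulrAC ler_pdivlMr //.
have := ler_wpM2l c_ge0 denom; lra.
Qed.

(** The Sherman-Morrison formula. *)
Lemma pivot_inverse : pivot_mx \in unitmx /\
  invmx pivot_mx = \matrix_(u, v) ((u == v)%:R * (x v / s ^+ 2) + g / s ^+ 2 * x u * x v).
Proof.
set Q := \matrix_(_, _) _.
have PQ : pivot_mx *m Q = 1%:M.
  apply/matrixP => u v; rewrite mxE.
  transitivity (\sum_t ((u == t)%:R * (s ^+ 2 / x u * ((t == v)%:R * (x v / s ^+ 2) + g / s ^+ 2 * x t * x v))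
     - (c * (x v / s ^+ 2)) * ((v == t)%:R * 1) - c * (g / s ^+ 2 * x v) * x t)).
    by apply: eq_bigr => t _; rewrite !mxE [v == t]eq_sym; ring.
  rewrite !sumrB sum_delta -!mulr_sumr (sum_delta v (fun=> 1)) !mxE.
  have e1 : s ^+ 2 / x u * ((u == v)%:R * (x v / s ^+ 2)) = (u == v)%:R.
    have [->|_] := eqVneq u v; last by rewrite /= mul0r mulr0.
    by rewrite /= mul1r; field; rewrite !gt_eqF.
  rewrite mulrDr e1 -!addrA -[RHS]addr0; congr (_ + _).
  by rewrite /g; field; rewrite !gt_eqF.
have [Pu _] := mulmx1_unit PQ; split=> //.
by rewrite -[RHS](mulKmx Pu) PQ mulmx1.
Qed.

Lemma pivot_sym : pivot_mx^T = pivot_mx.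
Proof.
apply/matrixP => u v; rewrite !mxE eq_sym; have [->|] := eqVneq u v => //.
by rewrite !mul0r.
Qed.

Lemma pivot_psd : psd pivot_mx.
Proof.
split; first by apply/symmetricmxP; exact: pivot_sym.
move=> z; rewrite quadE.
have -> : \sum_u \sum_v z u 0 * pivot_mx u v * z v 0 =
    \sum_u s ^+ 2 / x u * z u 0 ^+ 2 - c * (\sum_u z u 0) ^+ 2.
  have -> : c * (\sum_u z u 0) ^+ 2 = \sum_u c * z u 0 * (\sum_v z v 0).
    by rewrite -mulr_suml -mulr_sumr expr2 mulrA.
  rewrite -sumrB; apply: eq_bigr => u _.
  transitivity (\sum_v ((u == v)%:R * (s ^+ 2 / x u * z u 0 * z v 0) - c * z u 0 * z v 0)).
    by apply: eq_bigr => v _; rewrite mxE; ring.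
  by rewrite sumrB sum_delta -mulr_sumr; congr (_ - _); ring.
have cs : (\sum_u z u 0) ^+ 2 <= J%:R * \sum_u z u 0 ^+ 2.
  have := cauchy (const_mx 1 : 'rV[R]_J) z^T.
  have -> : dot (const_mx 1) z^T = \sum_u z u 0.
    by rewrite dotE; apply: eq_bigr => u _; rewrite !mxE mul1r.
  have -> : dot (const_mx 1 : 'rV[R]_J) (const_mx 1) = J%:R.
    rewrite dotE (eq_bigr (fun=> 1)) ?sumr_const ?card_ord // => u _.
    by rewrite !mxE mul1r.
  have -> : dot z^T z^T = \sum_u z u 0 ^+ 2.
    by rewrite dotE; apply: eq_bigr => u _; rewrite !mxE.
  by [].
have lo : s ^+ 2 / 2 * \sum_u z u 0 ^+ 2 <= \sum_u s ^+ 2 / x u * z u 0 ^+ 2.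
  rewrite mulr_sumr; apply: ler_sum => u _; rewrite ler_wpM2r ?sqr_ge0 //.
  rewrite ler_wpM2l ?sqr_ge0 // lef_pV2 ?posrE //.
  by case/andP: (x_bounds u).
have h := ler_wpM2l c_ge0 cs.
have z0 : 0 <= \sum_u z u 0 ^+ 2 by apply: sumr_ge0 => u _; exact: sqr_ge0.
have := ler_wpM2r z0 s_large; have := mulr_ge0 (mulr_ge0 c_ge0 (ler0n R J)) z0.
lra.
Qed.

(** The diagonal part of the inverse contributes the weights x, independently of s; the
    rank one part vanishes as s grows. *)
Lemma pivot_schur nI (kap : 'I_nI -> 'I_J -> R) (L : 'M[R]_(nI, J)) :
  (forall k u, L k u = s * kap k u) -> (forall k u, 0 <= kap k u <= 1) ->
  exists E : 'I_nI -> 'I_nI -> R,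
    (forall k l, 0 <= E k l <= 2 * c / s ^+ 2 * (2 * J%:R) ^+ 2) /\
    forall k l, (L *m invmx pivot_mx *m L^T) k l =
      \sum_u x u * kap k u * kap l u + E k l.
Proof.
move=> LE kapP.
pose alpha k := \sum_u x u * kap k u.
exists (fun k l => g * (alpha k * alpha l)); split=> k l.
  have a0 i : 0 <= alpha i <= 2 * J%:R.
    apply/andP; split.
      by apply: sumr_ge0 => u _; rewrite mulr_ge0 ?(ltW (X0 u)) //; case/andP: (kapP i u).
    apply: le_trans sum_le; apply: ler_sum => u _; rewrite ler_piMr ?(ltW (X0 u)) //.
    by case/andP: (kapP i u).
  have /andP[k0 k1] := a0 k; have /andP[l0 l1] := a0 l.
  apply/andP; split; first by apply: mulr_ge0 => //; apply: mulr_ge0.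
  by apply: ler_pM => //; [apply: mulr_ge0 | rewrite expr2; apply: ler_pM].
have [_ ->] := pivot_inverse.
rewrite mxE.
transitivity (\sum_v \sum_u L k u * ((u == v)%:R * (x v / s ^+ 2) + g / s ^+ 2 * x u * x v) * L l v).
  apply: eq_bigr => v _; rewrite !mxE mulr_suml; apply: eq_bigr => u _.
  by rewrite !mxE.
have -> : g * (alpha k * alpha l) = \sum_v g * alpha k * (x v * kap l v).
  by rewrite -mulr_sumr mulrA.
rewrite -big_split /=; apply: eq_bigr => v _.
transitivity (\sum_u ((v == u)%:R * (L k u * (x v / s ^+ 2) * L l v)
    + (g / s ^+ 2 * x v * L l v * s) * (x u * kap k u))).
  by apply: eq_bigr => u _; rewrite [v == u]eq_sym !LE; ring.
rewrite big_split /= sum_delta -mulr_sumr -/(alpha k) !LE.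
by field; rewrite gt_eqF.
Qed.

End RankOnePerturbation.

(** * From colourings to low rank *)

Lemma copy_nonedge (K : sgraph) (exposed : K -> 'I_3) (x : robust 5 exposed) :
  exists y : robust 5 exposed, nonedge x y.
Proof.
case: x => [[g a] t]; exists (g, a, if t == ord0 then ord_max else ord0).
rewrite /nonedge /= !xpair_eqE !eqxx /= adj_irrefl andbT.
by case: (eqVneq t ord0) => [->|].
Qed.

Lemma vertices_le_nonedges (K : sgraph) (exposed : K -> 'I_3) :
  (#|robust 5 exposed| <= 2 * #|nonedges (robust 5 exposed)|)%N.
Proof.
have nS : symmetric (@nonedge (robust 5 exposed)).
  by move=> x y; rewrite /nonedge eq_sym adj_sym.
have nI : irreflexive (@nonedge (robust 5 exposed)) by move=> x; rewrite /nonedge eqxx.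
rewrite /nonedges -(card_unordered_pairs nS nI).
have [c cP] := fin_all_exists (@copy_nonedge K exposed).
rewrite -(card_imset predT (_ : injective (fun x => (x, c x)))); last by move=> x y [].
by apply: subset_leq_card; apply/subsetP => _ /imsetP[x _ ->]; rewrite inE; exact: cP.
Qed.

Section Positive.
Variables (R : realType) (G : sgraph).
Let I : finType := 'I_(3 * #|G|).
Let J : finType := 'I_(9 * #|nonedges G|).

(** For a proper colouring f, the target of the Schur complement is the Gram matrix
    X of the unit vectors indexed by the colours.  The weights x_u = 2 - X(k,l) of
    the columns u = (k, l) correct the nonedge entries of A; they are 1 or 2, hence
    positive, because those entries of A are 2 and X is at most 1.  What remains is
    an error of order delta, which H absorbs. *)
Theorem low_rank_of_colorable (s delta eps phat : R) :
  let m := #|nonedges G| in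
  let N := (9 * m + 3 * #|G|)%N in
  let c := 2 * phat * eps in
  colorable 3 G ->
  0 < delta -> delta <= 1 -> 0 <= c -> 0 < s -> 0 < eps ->
  4 * c * (9 * m)%:R <= s ^+ 2 -> 8 * c * (9 * m)%:R <= delta * s ^+ 2 ->
  (3 * #|G|)%:R * (3 * (9 * m)%:R * delta) <= eps ->
  exists (H : 'M[R]_N) (d : 'rV[R]_N),
    [/\ H \is symmetricmx, frobenius H <= eps,
        psd (mxB G s delta eps phat + diag_mx d + H)
      & (\rank (mxB G s delta eps phat + diag_mx d + H)%R <= 9 * m + 3)%N].
Proof.
move=> m N c [f fP] d0 d1 c0 s0 e0 s1 s2 dN.
pose same k l := f (@parent G k) == f (@parent G l).
pose x (u : J) : R := if [forall k in @index_pair G u, forall l in @index_pair G u, same k l]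
  then 1 else 2.
have xb u : 1 <= x u <= 2 by rewrite /x; case: ifP => _; apply/andP; split; lra.
have xE (u : J) k l : @index_pair G u = [set k; l] -> x u = 2 - (same k l)%:R.
  move=> uE; rewrite /x uE; case: ifP => [/forall_inP/(_ _ (set21 _ _))/forall_inP/(_ _ (set22 _ _)) ->|h].
    by rewrite mulr1n; lra.
  case kl: (same k l); last by rewrite subr0.
  case/negP: h; apply/forall_inP => i /set2P ik; apply/forall_inP => j /set2P jk.
  by case: ik jk => -> [] ->; rewrite /same ?eqxx // -/(same _ _) // /same eq_sym.
pose F : 'M[R]_(3 * #|G|, 3) := \matrix_(k, i) (f (parent k) == i)%:R.
have XE k l : (F *m F^T) k l = (same k l)%:R.
  rewrite mxE (eq_bigr (fun i => (f (parent k) == i)%:R * (f (parent l) == i)%:R)).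
    by rewrite sum_delta eq_sym.
  by move=> i _; rewrite !mxE.
pose P := pivot_mx x s c; pose K := mxK G s delta.
have [Pu _] := pivot_inverse xb s0 c0 s1.
have KE (k : I) (u : J) : K k u = s * kappa delta k u.
  by rewrite mxE /kappa; case: ifP; rewrite ?mulr1.
have kapP (k : I) (u : J) : 0 <= kappa delta k u <= 1.
  by rewrite /kappa; case: ifP => _; apply/andP; split; lra.
have [E [EP WE]] := pivot_schur xb s0 c0 s1 KE kapP.
pose Z := F *m F^T + K *m invmx P *m K^T.
pose H22 : 'M[R]_(3 * #|G|) := \matrix_(k, l) if k == l then 0 else Z k l - mxA R G k l.
pose H : 'M[R]_N := block_mx 0 0 0 H22.
pose d : 'rV[R]_N := row_mx (\row_u (s ^+ 2 / x u - c)) (\row_k Z k k).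
have PT : P^T = P by exact: pivot_sym.
have ZT : Z^T = Z.
  by rewrite /Z linearD /= !trmx_mul !trmxK trmx_inv PT mulmxA.
have MB : mxB G s delta eps phat + diag_mx d + H = block_mx P K^T K Z.
  rewrite /mxB /H /d diag_mx_row !add_block_mx !addr0; congr block_mx.
    apply/matrixP => u v; rewrite !mxE; have [->|uv] := eqVneq u v.
      by rewrite mulr1n add0r mul1r.
    by rewrite mulr0n mul0r /c; ring.
  apply/matrixP => k l; rewrite [LHS]addmxE [X in X + _]addmxE [diag_mx _ _ _]mxE [(\row__ _) _ _]mxE.
  rewrite [H22 _ _]mxE; have [->|kl] := eqVneq k l.
    by rewrite mulr1n addr0 [mxA _ _ _ _]mxE eqxx add0r.
  by rewrite mulr0n addr0 addrCA subrr addr0.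
exists H, d; split.
- apply/symmetricmxP; rewrite /H tr_block_mx !trmx0; congr block_mx.
  apply/matrixP => k l; rewrite [LHS]mxE [H22 l k]mxE [H22 k l]mxE eq_sym.
  have -> : Z l k = Z k l by rewrite -{1}ZT mxE.
  have -> // : mxA R G l k = mxA R G k l.
  by rewrite !mxE eq_sym [parent l == _]eq_sym adj_sym.
- have err k l : `|H22 k l| <= 3 * (9 * m)%:R * delta.
    have M0 : 0 <= (9 * m)%:R :> R by exact: ler0n.
    rewrite mxE; have [_|kl] := eqVneq k l.
      by rewrite normr0 !mulr_ge0 // ltW.
    have E2 : E k l <= (9 * m)%:R * delta.
      case/andP: (EP k l) => _ /le_trans; apply.
      rewrite mulrAC ler_pdivrMr ?exprn_gt0 //.
      have := ler_wpM2l M0 s2; rewrite expr2; lra.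
    pose tm u := x u * kappa delta k u * kappa delta l u.
    have tm0 u : 0 <= tm u.
      have /andP[? ?] := xb u; have /andP[? ?] := kapP k u; have /andP[? ?] := kapP l u.
      by rewrite /tm !mulr_ge0 //; lra.
    have small (u : J) : ~~ ((k \in @index_pair G u) && (l \in @index_pair G u)) ->
        tm u <= 2 * delta.
      have /andP[x1 x2] := xb u; rewrite /tm /kappa -mulrA => kl'.
      apply: ler_pM => //; first by lra.
        by rewrite mulr_ge0 //; case: ifP => _ //; exact: ltW.
      move: kl'; case: (k \in _); case: (l \in _) => //= _; rewrite ?mul1r ?mulr1 //.
      by rewrite ler_piMr // ltW.
    have sums (Q : pred J) : (forall u, Q u -> tm u <= 2 * delta) ->
        \sum_(u | Q u) tm u <= (9 * m)%:R * (2 * delta).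
      move=> hQ; apply: (@le_trans _ _ (\sum_(u : J) 2 * delta)); last first.
        by rewrite sumr_const card_ord [leRHS]mulr_natl.
      rewrite [leRHS](bigID Q) /= -[leLHS]addr0 lerD ?ler_sum //.
      by apply: sumr_ge0 => u _; rewrite mulr_ge0 // ltW.
    suff [b [b0 b1 ZE]] : exists b, [/\ 0 <= b, b <= (9 * m)%:R * (2 * delta) &
        Z k l - mxA R G k l = b + E k l].
      by rewrite ZE; case/andP: (EP k l) => E0 _; rewrite ger0_norm ?addr_ge0 //; lra.
    rewrite /Z addmxE XE WE.
    have [ne|ne] := boolP (nonedge (@parent G k) (@parent G l)); last first.
      exists (\sum_u tm u); split; first exact: sumr_ge0.
        apply: sums => u _; apply: small; apply: contra ne => /andP[ku lu].
        exact: (index_pair_nonedge kl ku lu).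
      have -> : mxA R G k l = (same k l)%:R; last by ring.
      rewrite mxE (negbTE kl) /same; move: ne; rewrite /nonedge negb_and !negbK.
      case: eqP => [-> _|_ /= kla]; first by rewrite eqxx.
      by rewrite kla (negbTE (fP _ _ kla)).
    have iu : [set k; l] \in index_pairs G by apply/imsetP; exists (k, l); rewrite ?inE.
    pose u0 : J := cast_ord (card_index_pairs G) (enum_rank_in iu [set k; l]).
    have u0E : @index_pair G u0 = [set k; l].
      by rewrite /index_pair /u0 cast_ordK enum_rankK_in.
    exists (\sum_(u | u != u0) tm u); split; first exact: sumr_ge0.
      apply: sums => u uu0; apply: small; apply: contra uu0 => /andP[ku lu].
      have kl2 : [set k; l] \subset @index_pair G u.
        by apply/subsetP => i /set2P[->|->].
      have : [set k; l] == @index_pair G u.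
        by rewrite eqEcard kl2 card_index_pair cards2 kl.
      rewrite -u0E => /eqP E0; apply/eqP; apply: (can_inj (cast_ordK (esym (card_index_pairs G)))).
      by apply: enum_val_inj.
    rewrite (bigD1 u0) //= /kappa u0E !inE !eqxx orbT !mulr1 (xE _ k l) //.
    have -> : mxA R G k l = 2.
      by rewrite mxE (negbTE kl); case/andP: ne => /negbTE-> /negbTE->.
    rewrite -/(tm _); under [in RHS]eq_bigr => u _ do rewrite /tm /kappa.
    by rewrite !addrA; ring.
  rewrite /frobenius.
  have -> : \sum_i \sum_j H i j ^+ 2 = \sum_k \sum_l H22 k l ^+ 2.
    rewrite big_split_ord /= big1 ?add0r => [|u _]; last first.
      apply: big1 => j _; rewrite /H; case: (splitP j) => j' jE.
        by have -> : j = lshift _ j' by [exact: val_inj]; rewrite block_mxEul mxE expr0n.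
      by have -> : j = rshift _ j' by [exact: val_inj]; rewrite block_mxEur mxE expr0n.
    apply: eq_bigr => k _; rewrite big_split_ord /= big1 ?add0r => [|u _]; last first.
      by rewrite /H block_mxEdl mxE expr0n.
    by apply: eq_bigr => l _; rewrite /H block_mxEdr.
  have -> : eps = Num.sqrt (eps ^+ 2) by rewrite sqrtr_sqr ger0_norm // ltW.
  apply: ler_wsqrtr; set e := 3 * (9 * m)%:R * delta in err dN.
  have ee0 : 0 <= e by rewrite /e !mulr_ge0 // ltW.
  apply: (@le_trans _ _ (((3 * #|G|)%:R * e) ^+ 2)); last first.
    by rewrite lerXn2r // nnegrE ?mulr_ge0 // ltW.
  apply: (@le_trans _ _ (\sum_(k < 3 * #|G|) \sum_(l < 3 * #|G|) e ^+ 2)).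
    apply: ler_sum => k _; apply: ler_sum => l _.
    by rewrite -real_normK ?num_real // lerXn2r // nnegrE.
  by rewrite !sumr_const card_ord -mulrnA -[leLHS]mulr_natl natrM -expr2 [leRHS]exprMn.
- rewrite MB; apply/(psd_schur K Z Pu PT); split; first exact: pivot_psd.
  rewrite /Z addrK; split; first by apply/symmetricmxP; rewrite trmx_mul trmxK.
  move=> z; rewrite mulmxA -mulmxA.
  have -> : F^T *m z = (z^T *m F)^T by rewrite trmx_mul trmxK.
  exact: gram_diag_ge0.
- rewrite MB schur_rank // leq_add2l /Z addrK.
  by apply: leq_trans (mxrankM_maxl _ _) (rank_leq_col _).
Qed.

End Positive.

(** * The two directions together *)

Theorem theoremA2 (R : realType) :
  exists eps0 : R, 0 < eps0 /\
  forall (p : {poly R}) (G : sgraph)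
    (o : rel G) (ho : pair_listing o) (exposed : peeters o -> 'I_3),
  let Gstar := robust 5 exposed in
  let n := #|Gstar| in
  let m := #|nonedges Gstar| in
  let N := (9 * m + 3 * n)%N in
  let phat := p.[N%:R] in
  1 < phat ->
  forall eps : R, 0 < eps ->
  eps <= eps0 / (600 * m%:R ^+ 2 * n%:R * phat) ->
  let delta :=
    eps / (10 * 3 ^+ 4 * Num.sqrt 6 * m%:R ^+ 2 * Num.sqrt n%:R) in
  exists s0 : R, forall s : R, 0 < s -> s0 <= s ->
  let B := mxB Gstar s delta eps phat in
  (colorable 3 G ->
     exists (H : 'M[R]_N) (d : 'rV[R]_N),
       [/\ H \is symmetricmx, frobenius H <= eps,
           psd (B + diag_mx d + H)
         & (\rank (B + diag_mx d + H)%R <= 9 * m + 3)%N])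
  /\
  (~ colorable 3 G ->
     forall (H : 'M[R]_N) (d : 'rV[R]_N),
       H \is symmetricmx -> frobenius H <= phat * eps ->
       psd (B + diag_mx d + H) ->
       (9 * m + 4 <= \rank (B + diag_mx d + H)%R)%N).
Proof.
(* The vectors have squared norms up to 10^12, so that the b are at most of order
   10^12 n delta, and the gadget needs products accurate to about 10^-7. *)
exists (1 / 10 ^+ 22); split; first by rewrite divr_gt0 // exprn_gt0.
move=> p G o ho exposed Gstar n m N phat phat1 eps eps_gt0 eps_le delta.
(* If m or n were 0, the bound on eps would be 0, as a division by 0 gives 0. *)
have pos (a b : nat) : (0 < a * b)%N -> (0 < a)%N /\ (0 < b)%N.
  by rewrite muln_gt0 => /andP.
have [m_gt0 n_gt0] : (0 < m)%N /\ (0 < n)%N.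
  apply: pos; rewrite lt0n; apply/negP => /eqP mn0.
  have E : 600 * m%:R ^+ 2 * n%:R * phat = 0.
    have -> : 600 * m%:R ^+ 2 * n%:R * phat = 600 * m%:R * (m * n)%:R * phat.
      by rewrite natrM; ring.
    by rewrite mn0 mulr0 mul0r.
  by move: eps_le; rewrite E invr0 mulr0; lra.
have m0 : 0 < m%:R :> R by rewrite ltr0n.
have n0 : 0 < n%:R :> R by rewrite ltr0n.
have m1 : 1 <= m%:R :> R by rewrite ler1n.
have n1 : 1 <= n%:R :> R by rewrite ler1n.
have nm : n%:R <= 2 * m%:R :> R by rewrite -natrM ler_nat; exact: vertices_le_nonedges.
have r6 : 1 <= Num.sqrt 6 :> R by rewrite -[leLHS]sqrtr1 ler_wsqrtr //; lra.
have rn : 1 <= Num.sqrt n%:R :> R by rewrite -[leLHS]sqrtr1 ler_wsqrtr.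
have m2 : 1 <= m%:R ^+ 2 :> R by rewrite exprn_ege1.
have [h_gt0 h_le] : 0 < phat * eps /\ phat * eps * n%:R <= 1 / 10 ^+ 22.
  have phat0 : 0 < phat by lra.
  split; first exact: mulr_gt0.
  have D0 : 0 < 600 * m%:R ^+ 2 * n%:R * phat.
    by rewrite !mulr_gt0 ?exprn_gt0.
  move: eps_le; rewrite ler_pdivlMr // => h; apply: le_trans h.
  have -> : eps * (600 * m%:R ^+ 2 * n%:R * phat) =
      (phat * eps * n%:R) * (600 * m%:R ^+ 2) by ring.
  rewrite ler_peMr //; last by lra.
  by rewrite ltW // !mulr_gt0.
pose D : R := 10 * 3 ^+ 4 * Num.sqrt 6 * m%:R ^+ 2 * Num.sqrt n%:R.
have D810 : 810 * m%:R ^+ 2 <= D.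
  have e1 : 810 * m%:R ^+ 2 * 1 <= 810 * m%:R ^+ 2 * Num.sqrt 6 :> R.
    by rewrite ler_wpM2l // mulr_ge0 ?sqr_ge0.
  have e2 : 810 * m%:R ^+ 2 * Num.sqrt 6 * 1 <=
      810 * m%:R ^+ 2 * Num.sqrt 6 * Num.sqrt n%:R :> R.
    by rewrite ler_wpM2l // !mulr_ge0 ?sqr_ge0 ?sqrtr_ge0.
  by rewrite /D; lra.
have D_gt0 : 0 < D by lra.
have dD : delta * D = eps by rewrite /delta -/D divfK // gt_eqF.
have delta_gt0 : 0 < delta by rewrite divr_gt0.
have delta_eps : delta <= eps.
  by rewrite -dD ler_peMr ?(ltW delta_gt0) //; lra.
have eps_h : eps * n%:R <= 1 / 10 ^+ 22.
  apply: le_trans h_le; rewrite ler_wpM2r ?ler0n // ler_peMl ?(ltW eps_gt0) //.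
  exact: ltW.
have delta_n : delta * n%:R <= 1 / 10 ^+ 22.
  by apply: le_trans eps_h; rewrite ler_wpM2r.
have delta1 : delta <= 1.
  have : delta * 1 <= delta * n%:R by rewrite ler_wpM2l // ltW.
  by lra.
have h_small : phat * eps <= 1 / 10 ^+ 22.
  have : phat * eps * 1 <= phat * eps * n%:R by rewrite ler_wpM2l // ltW.
  by lra.
pose c := 2 * phat * eps; pose T : R := 252 / delta ^+ 2.
have c_ge0 : 0 <= c by rewrite /c -mulrA mulr_ge0 // ltW.
have T_gt0 : 0 < T by rewrite divr_gt0 // exprn_gt0.
(* Lower bounds on s for the positivity of L, the diagonal form of the inverse, the
   positivity of the pivot block, and the error of its rank one part. *)
pose t1 := 2 * (phat * eps) / delta.
pose t2 := 12 * (9 * m)%:R ^+ 2 * T ^+ 2 + 3 * T.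
pose t3 := 4 * c * (9 * m)%:R; pose t4 := 8 * c * (9 * m)%:R / delta.
have t10 : 0 <= t1 by apply: divr_ge0; [apply: mulr_ge0 => // |]; exact: ltW.
have t20 : 0 <= t2.
  apply: addr_ge0; last by apply: mulr_ge0 => //; exact: ltW.
  by apply: mulr_ge0; [apply: mulr_ge0 => // |]; exact: sqr_ge0.
have t30 : 0 <= t3 by apply: mulr_ge0 => //; apply: mulr_ge0.
have t40 : 0 <= t4.
  by apply: divr_ge0; [apply: mulr_ge0 => //; apply: mulr_ge0 | exact: ltW].
exists (1 + t1 + t2 + t3 + t4) => s s_gt0 s_large B.
have s1 : 1 <= s by lra.
have ss : s <= s ^+ 2 by rewrite expr2 ler_peMr // ltW.
split=> [Gcol|Gncol H d Hsym Hle Mpsd].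
  apply: low_rank_of_colorable => //.
  - exact/robust_colorable/peeters_colorable.
  - by apply: le_trans ss; rewrite -/c -/t3; lra.
  - rewrite -/c [delta * _]mulrC -ler_pdivrMr //.
    by apply: le_trans ss; rewrite -/t4; lra.
  - rewrite -[leRHS]dD mulrA [leLHS]mulrC ler_wpM2l ?(ltW delta_gt0) //.
    apply: le_trans D810; rewrite !natrM -/n -/m.
    have : m%:R * n%:R <= m%:R * (2 * m%:R) :> R by rewrite ler_wpM2l.
    by have := sqr_ge0 (m%:R : R); lra.
rewrite leqNgt; apply/negP => rk; apply: Gncol.
apply: (@colorable_of_low_rank R G o exposed ho n_gt0 s delta eps phat H d) => //.
- lra.
- by rewrite natrM -/n; lra.
- by rewrite -ler_pdivrMr // -/t1; lra.
- by rewrite -/m -/T -/t2; lra.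
- by move: rk; rewrite addn4 addn3 ltnS.
Qed.
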